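(* Let $A \in L(\mathcal{H})$ have closed range, let $B\in L(\mathcal{H})$, and let $W \in L(\mathcal{H})^{+}$ be such that $W^{1/2} \in S_p$ for some $p$ with $1 \leq p < \infty$. Then the minimum $$\min_{X \in L(\mathcal{H})} \Vert AX-B\Vert_{p,W}$$ exists (i.e. is attained) if and only if $R(B) \subseteq R(A) + R(A)^{\perp_{W}}$. In this case, $$\min_{X \in L(\mathcal{H})}\Vert AX-B\Vert_{p,W} = \Vert W_{/R(A)}^{1/2}B\Vert_p .$$ Moreover, in this case, $X_0 \in L(\mathcal{H})$ satisfies $\Vert AX_0-B\Vert_{p,W} = \Vert W_{/R(A)}^{1/2}B\Vert_p$ if and only if $X_0$ is a $W$-inverse of $A$ in $R(B)$.
   Context: $\mathcal{H}$ is a separable complex Hilbert space, $L(\mathcal{H})$ is the algebra of bounded linear operators on $\mathcal{H}$, $L(\mathcal{H})^{+}$ is the cone of positive semidefinite operators, and $R(T)$ denotes the range of $T$. The operator order is: $S\le T$ if $T-S\in L(\mathcal{H})^{+}$. For $1\le p<\infty$, $S_p$ is the $p$-Schatten class: the compact $T\in L(\mathcal{H})$ with $\sum_k\lambda_k(T)^p<\infty$, where $\lambda_k(T)$ are the eigenvalues of $|T|=(T^*T)^{1/2}$ repeated according to multiplicity; its norm is $\Vert T\Vert_p=(\sum_k\lambda_k(T)^p)^{1/p}$. For $W\in L(\mathcal{H})^+$ with $W^{1/2}\in S_p$ and $X\in L(\mathcal{H})$, $\Vert X\Vert_{p,W}=\Vert W^{1/2}X\Vert_p$. For $W\in L(\mathcal{H})^{+}$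 and a closed subspace $\mathcal{S}\subseteq\mathcal{H}$: the $W$-orthogonal complement of $\mathcal{S}$ is $\mathcal{S}^{\perp_W}=\{x\in\mathcal{H}:\langle Wx,y\rangle=0 \text{ for all } y\in\mathcal{S}\}=W^{-1}(\mathcal{S}^\perp)$ (preimage); the shorted operator of $W$ to $\mathcal{S}$ is $W_{/\mathcal{S}}=\max\{X\in L(\mathcal{H}): 0\le X\le W \text{ and } R(X)\subseteq \mathcal{S}^{\perp}\}$ (this maximum is known to exist), and $W_{/\mathcal{S}}^{1/2}$ denotes its positive square root. Let $\Vert x\Vert_W=\langle Wx,x\rangle^{1/2}$. An operator $X_0\in L(\mathcal{H})$ is a $W$-inverse of $A$ in $R(B)$ if $\Vert AX_0x-Bx\Vert_W\le\Vert Az-Bx\Vert_W$ for every $x,z\in\mathcal{H}$. *)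

(* Defs.v *)
From HB Require Import structures.
From mathcomp Require Import all_boot all_order all_algebra.
From mathcomp Require Import all_classical all_reals all_analysis.
From mathcomp Require Import complex.

Set Implicit Arguments.
Unset Strict Implicit.
Unset Printing Implicit Defensive.

Import Order.TTheory GRing.Theory Num.Theory.
Import numFieldNormedType.Exports.

Local Open Scope classical_set_scope.
Local Open Scope ring_scope.
Local Open Scope complex_scope.

(* The inner product is linear in its first argument and conjugate-linear in
   the second one; the norm of H, as that of any normed module over R[i], takes
   its values in R[i]. *)
HB.mixin Record CompleteNormedModule_isHilbert (R : realType) H
    & CompleteNormedModule R[i] H := {
  inner : {dot H for (@Num.conj R[i])} ;
  inner_norm : forall x : H, inner x x = `|x| ^+ 2
}.

#[short(type="hilbertType")]
HB.structure Definition Hilbert (R : realType) :=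
  {H of CompleteNormedModule R[i] H & CompleteNormedModule_isHilbert R H}.

Definition separable_space (T : topologicalType) : Prop :=
  exists D : set T, countable D /\ dense D.

Definition is_minimum (R : realType) (E : set (\bar R)) (m : \bar R) : Prop :=
  E m /\ lbound E m.

Definition lin_indep (K : pzRingType) (V : lmodType K) (n : nat)
    (e : 'I_n -> V) : Prop :=
  forall c : 'I_n -> K, \sum_(i < n) c i *: e i = 0 -> forall i, c i = 0.

Section Operators.
Context {R : realType} {H : hilbertType R}.
Implicit Types (S T W X A B : H -> H) (V : set H) (p : R).

(* The bounded linear operators L(H), as a set of functions. *)
Definition bounded_op : set (H -> H) :=
  [set T | linear T /\ exists M : R[i], forall x, `|T x| <= M * `|x|].

(* In R[i], 0 <= z means that z is real and nonnegative, so these are the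
   positive semidefinite (hence self-adjoint) operators. *)
Definition positive_op : set (H -> H) :=
  [set T | bounded_op T /\ forall x, 0 <= inner (T x) x].

Definition op_le S T : Prop := positive_op (T \- S).

Definition adjoint_op T : H -> H :=
  get [set S | bounded_op S /\ forall x y, inner (T x) y = inner x (S y)].

Definition sqrt_op W : H -> H :=
  get [set Q | positive_op Q /\ Q \o Q = W].

Definition abs_op T : H -> H := sqrt_op (adjoint_op T \o T).

Definition compact_op : set (H -> H) :=
  [set T | bounded_op T /\ precompact (T @` [set x | `|x| <= 1])].

(* Algebraic dimension; +oo when V contains arbitrarily large independent
   families. *)
Definition subspace_dim V : \bar R :=
  ereal_sup [set n%:R%:E | n in
    [set n : nat | exists e : 'I_n -> H, (forall i, V (e i)) /\ lin_indep e]].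

Definition eigenspace_op T (l : R) : set H := [set x | T x = l%:C *: x].

(* The sum of the p-th powers of the eigenvalues of |T| repeated according to
   multiplicity: each l > 0 contributes as many times as the dimension of its
   eigenspace (zero if l is not an eigenvalue). The eigenvalue 0 is left out,
   as 0 `^ p = 0. *)
Definition schatten_sum p T : \bar R :=
  (\esum_(l in [set l : R | (0 < l)%R])
     subspace_dim (eigenspace_op (abs_op T) l) * (l `^ p)%:E)%E.

Definition schatten_class p : set (H -> H) :=
  [set T | compact_op T /\ (schatten_sum p T < +oo)%E].

(* Meaningful for T in schatten_class p only. *)
Definition schatten_norm p T : \bar R := (schatten_sum p T `^ p^-1)%E.

Definition schatten_normW p W X : \bar R := schatten_norm p (sqrt_op W \o X).

Definition ortho V : set H := [set x | forall y, V y -> inner x y = 0].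

Definition orthoW W V : set H := [set x | forall y, V y -> inner (W x) y = 0].

Definition sum_set V V' : set H := [set x + y | x in V & y in V'].

Definition shorted_candidate W V : set (H -> H) :=
  [set X | [/\ positive_op X, op_le X W & range X `<=` ortho V]].

Definition shorted W V : H -> H :=
  get [set X | shorted_candidate W V X /\
               forall Y, shorted_candidate W V Y -> op_le Y X].

Definition seminormW W (x : H) : R[i] := sqrtC (inner (W x) x).

Definition W_inverse W A B : set (H -> H) :=
  [set X0 | bounded_op X0 /\ forall x z,
     seminormW W (A (X0 x) - B x) <= seminormW W (A z - B x)].

End Operators.

(* Main.v *)
Require Import Defs.
From HB Require Import structures.
From mathcomp Require Import all_boot all_order all_algebra.
From mathcomp Require Import all_classical all_reals all_analysis.
From mathcomp Require Import complex.
From mathcomp Require Import ring lra.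

(** Write [Q] for the positive square root of [W], [M] for the range of [A] and
    [P] for the orthogonal projection onto the orthocomplement of [Q M].

    For every bounded [X], the projection [P] annihilates [Q A X], so the
    residual [T_X = Q (A X - B)] satisfies [P T_X = - P Q B], which does not
    depend on [X]. Therefore [|P Q B x| <= |T_X x|] for all [x]
    ([optimal_error_le]), and equality at [x] says that [A X x] is a best
    approximation of [B x] in [M] for the seminorm of [W]. Moreover the shorted
    operator of [W] to [M] is [Q P Q] ([shortedE]), so that the square root of
    the shorted operator, applied to [B x], also has norm [|P Q B x|]. The three
    claims now follow from one fact: the Schatten sum is strictly monotone for
    the pointwise order. If [|S x| <= |T x|] for all [x], then the sum of [S] is
    at most that of [T] ([schatten_sum_mono]), and if the two sums are equal and
    finite, then [|S x| = |T x|] for all [x] ([schatten_sum_strict]).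

    - Lower bound and characterization of the minimizers: take [S = P Q B] and
      [T = T_X]; all the sums are finite by [schatten_sum_comp_fin].
    - Existence of a minimizer under the range condition: the condition says
      that the normal equation [A' W A y = A' W B x] (with [A'] the adjoint of
      [A]) is solvable for every [x]. The solution orthogonal to the kernel of
      [A' W A] depends linearly on [x], and it does so boundedly: this is a
      closed graph argument ([solution_bounded]), which rests on the uniform
      boundedness principle ([uniform_boundedness]).
    - Necessity of the range condition: if [T_X x] is not orthogonal to some
      [Q A y], subtracting from [T_X] its component along [Q A y] is a rank one
      change of [X] which never increases the pointwise norms and decreases one
      of them ([error_descent]). By strict monotonicity [X] is not a minimizer.
      No differentiability of the norm is involved, so [p = 1] is not special.

    Strict monotonicity comes from a variational formula: for [p >= 1], the
    Schatten sum of [T] is the supremum of the sums of [<|T| e, e> ^ p] over the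
    finite orthonormal sequences of vectors [e]. Jensen's inequality shows that
    such a sum never exceeds the supremum over eigenvectors of [|T|]
    ([powsum_le_eigen]), and the latter is the sum over eigenvalues counted with
    multiplicity ([powsum_le_eigensum], [eigensum_le]). Monotonicity is then the
    operator monotonicity of the square root ([sqrt_monotone]), which turns
    [|S x| <= |T x|] into [|S| <= |T|]. As for strictness, the eigenvectors of
    [|S|] have no common orthogonal vector ([ortho_eigenvectors]), so if [|S|]
    and [|T|] differ then [<|S| f, f> < <|T| f, f>] for a unit eigenvector [f]
    of [|S|]; comparing only the sequences that start with [f] shows a definite
    gap between the two sums.

    The operator theory below is developed on the real inner product
    [Re <x, y>]: it determines the complex one, and it turns most arguments into
    inequalities between real numbers. *)

Set Implicit Arguments.
Unset Strict Implicit.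
Unset Printing Implicit Defensive.

Import Order.TTheory GRing.Theory Num.Theory.
Import numFieldNormedType.Exports.

Local Open Scope classical_set_scope.
Local Open Scope ring_scope.
Local Open Scope complex_scope.

(** * Inequalities and sums of reals *)

(** The discriminant of a nonnegative quadratic polynomial; every Cauchy-Schwarz
    inequality below is an instance. *)
Lemma CS_real (R : realType) (a b c : R) :
  0 <= c ->
  (forall t, 0 <= a + 2 * t * b + t ^+ 2 * c) -> b ^+ 2 <= a * c.
Proof.
move=> c0 q.
case: (ltrP 0 c) => [c1|c1]; last first.
  have {c1}c00 : c = 0 by apply/eqP; rewrite eq_le c1.
  have [->|b0] := eqVneq b 0; first by rewrite expr0n /= c00 mulr0.
  have := q (- (a + 1) / (2 * b)); rewrite c00 mulr0 addr0.
  have -> : 2 * (- (a + 1) / (2 * b)) * b = - (a + 1) by field.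
  by lra.
have := q (- b / c).
have -> : a + 2 * (- b / c) * b + (- b / c) ^+ 2 * c = (a * c - b ^+ 2) / c.
  by field; rewrite gt_eqF.
by rewrite pmulr_lge0 ?invr_gt0 // subr_ge0.
Qed.

(** The bound is only required for [e <= 1], so that terms quadratic in [e] can be
    absorbed in the linear one. *)
Lemma small_le0 (R : realFieldType) (a K : R) : 0 < K ->
  (forall e, 0 < e -> e <= 1 -> a <= K * e) -> a <= 0.
Proof.
move=> K0 h; rewrite leNgt; apply/negP => a0.
have e0 : 0 < a / (2 * K) by rewrite divr_gt0 // mulr_gt0.
have := h (Num.min 1 (a / (2 * K))); rewrite lt_min ltr01 e0 ge_min lexx => /(_ isT isT).
apply/negP; rewrite -ltNge (@le_lt_trans _ _ (K * (a / (2 * K)))) //.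
  by rewrite ler_pM2l // ge_min lexx orbT.
have -> : K * (a / (2 * K)) = a / 2 by field; rewrite gt_eqF.
lra.
Qed.

Lemma invS_small (R : realType) (e : R) : 0 < e ->
  exists N, forall n, (N <= n)%N -> n.+1%:R^-1 <= e.
Proof.
move=> e0; exists (Num.truncn e^-1) => n Nn; rewrite invf_ple ?posrE //.
by rewrite (le_trans (ltW (truncnS_gt _))) // ler_nat ltnS.
Qed.

(** Young's inequality for [a] and [1] with the exponent [p] and its conjugate. *)
Lemma bernoulli_powR (R : realType) (p a : R) : 1 <= p -> 0 <= a ->
  1 + p * (a - 1) <= a `^ p.
Proof.
rewrite le_eqVlt => /predU1P[<- a0|p1 a0]; first by rewrite powRr1 // mul1r addrC subrK.
have p0 : 0 < p by apply: lt_trans p1.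
have q0 : 0 < p - 1 by rewrite subr_gt0.
have := @conjugate_powR R a 1 p (p / (p - 1)) a0 ler01 p0 (divr_gt0 p0 q0).
have -> : p^-1 + (p / (p - 1))^-1 = 1 by field; rewrite !gt_eqF.
move=> /(_ erefl); rewrite powR1 mulr1 mul1r invf_div => h.
have : p * a <= p * (a `^ p / p + (p - 1) / p) by rewrite ler_pM2l.
have -> : p * (a `^ p / p + (p - 1) / p) = a `^ p + p - 1 by field; rewrite gt_eqF.
by lra.
Qed.

(** Bernoulli at [a / c]; the left-hand side is the tangent at [c] of the power
    function. *)
Lemma tangent_powR (R : realType) (p a c : R) : 1 <= p -> 0 <= a -> 0 < c ->
  c `^ p * (1 + p * (a / c - 1)) <= a `^ p.
Proof.
move=> p1 a0 c0; have ac : 0 <= a / c by rewrite divr_ge0 // ltW.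
have -> : a `^ p = c `^ p * (a / c) `^ p.
  by rewrite -powRM ?(ltW c0) // mulrC divfK // gt_eqF.
by rewrite ler_wpM2l ?powR_ge0 // bernoulli_powR.
Qed.

(** The weights may have total mass less than one, since the missing mass can be
    put at [0]. The proof bounds each power from below by the tangent at the
    barycenter. *)
Lemma jensen_powR (R : realType) (I : Type) (s : seq I) (w a : I -> R) (p : R) :
  1 <= p -> (forall i, 0 <= w i) -> (forall i, 0 <= a i) -> \sum_(i <- s) w i <= 1 ->
  (\sum_(i <- s) w i * a i) `^ p <= \sum_(i <- s) w i * a i `^ p.
Proof.
move=> p1 w0 a0 w1; set c := \sum_(i <- s) w i * a i.
have c0 : 0 <= c by apply: sumr_ge0 => i _; rewrite mulr_ge0.
move: c0; rewrite le_eqVlt => /predU1P[<-|c0].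
  rewrite powR0 ?gt_eqF //; last by apply: lt_le_trans p1.
  by apply: sumr_ge0 => i _; rewrite mulr_ge0 // powR_ge0.
have : \sum_(i <- s) w i * (c `^ p * (1 + p * (a i / c - 1))) <= \sum_(i <- s) w i * a i `^ p.
  by apply: ler_sum => i _; rewrite ler_wpM2l // tangent_powR.
apply: le_trans.
have -> : \sum_(i <- s) w i * (c `^ p * (1 + p * (a i / c - 1))) =
   c `^ p * ((1 - p) * \sum_(i <- s) w i + p / c * c).
  rewrite {5}/c !mulr_sumr -big_split /= mulr_sumr; apply: eq_bigr => i _; field.
  by rewrite gt_eqF.
rewrite divfK ?gt_eqF // ler_peMr ?powR_ge0 //.
have : (1 - p) * 1 <= (1 - p) * \sum_(i <- s) w i by rewrite ler_wnM2l // subr_le0.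
lra.
Qed.

Lemma count_le_sum (R : numDomainType) (I : eqType) (s : seq I) (a : pred I)
    (F : I -> R) (c : R) :
  (forall i, 0 <= F i) -> (forall i, i \in s -> a i -> c <= F i) ->
  (count a s)%:R * c <= \sum_(i <- s) F i.
Proof.
move=> F0; elim: s => [|i s IH] h; first by rewrite big_nil mul0r.
rewrite big_cons /= natrD mulrDl lerD //; last first.
  by apply: IH => j js; apply: h; rewrite inE js orbT.
by case: (boolP (a i)) => ai; rewrite ?mul1r ?mul0r // h ?mem_head.
Qed.

Lemma sum_count (R : pzRingType) (I J : eqType) (s : seq I) (u : seq J) (q : I -> J)
    (F : J -> R) : uniq u ->
  \sum_(l <- u) (count (fun i => q i == l) s)%:R * F l =
  \sum_(i <- s | q i \in u) F (q i).
Proof.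
move=> uu; elim: s => [|i s IH].
  by rewrite big_nil big1 // => l _; rewrite mul0r.
rewrite big_cons -IH /=; under eq_bigr do rewrite natrD mulrDl.
rewrite big_split /=; case: ifPn => qi; last first.
  rewrite big_seq big1 ?add0r // => l lu; case: eqP => [ql|]; last by rewrite mul0r.
  by rewrite ql lu in qi.
congr (_ + _); rewrite (bigD1_seq (q i)) //= eqxx mul1r big1 ?addr0 // => l.
by rewrite eq_sym => /negbTE ->; rewrite mul0r.
Qed.

(** * The real structure of a complex Hilbert space *)

Section RealStructure.
Context {R : realType} {H : hilbertType R}.
Implicit Types (x y z : H) (r : R).

Definition rnorm x : R := complex.Re `|x|.

(** The real inner product; together with multiplication by ['i] it determines the
    complex one, see [innerE]. *)
Definition rdot x y : R := complex.Re (inner x y).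

Lemma innerDl x y z : inner (x + y) z = inner x z + inner y z.
Proof. exact: linearDl. Qed.

Lemma innerNl x y : inner (- x) y = - inner x y.
Proof. exact: linearNl. Qed.

Lemma innerBl x y z : inner (x - y) z = inner x z - inner y z.
Proof. by rewrite innerDl innerNl. Qed.

Lemma innerZl a x y : inner (a *: x) y = a * inner x y.
Proof. exact: linearZl_LR. Qed.

Lemma innerZr a x y : inner x (a *: y) = conjc a * inner x y.
Proof. exact: linearZr_LR. Qed.

Lemma innerC x y : inner x y = conjc (inner y x).
Proof. by rewrite hermC mul1r. Qed.

Lemma rnormE x : `|x| = (rnorm x)%:C.
Proof. by rewrite /rnorm RRe_real // ger0_real. Qed.

Lemma rnorm_ge0 x : 0 <= rnorm x.
Proof. by rewrite -ler0c -rnormE. Qed.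

Lemma rnorm0 : rnorm 0 = 0.
Proof. by rewrite /rnorm normr0. Qed.

Lemma rnormN x : rnorm (- x) = rnorm x.
Proof. by rewrite /rnorm normrN. Qed.

Lemma rnormBC x y : rnorm (x - y) = rnorm (y - x).
Proof. by rewrite /rnorm distrC. Qed.

Lemma rnorm_eq0 x : (rnorm x == 0) = (x == 0).
Proof. by rewrite -[RHS]normr_eq0 rnormE (inj_eq (@complexI R)). Qed.

Lemma rnorm_gt0 x : (0 < rnorm x) = (x != 0).
Proof. by rewrite lt_neqAle eq_sym rnorm_eq0 rnorm_ge0 andbT. Qed.

Lemma rnormD x y : rnorm (x + y) <= rnorm x + rnorm y.
Proof. by rewrite -lecR rmorphD /= -!rnormE ler_normD. Qed.

Lemma rnormB x y : rnorm (x - y) <= rnorm x + rnorm y.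
Proof. by rewrite -(rnormN y) rnormD. Qed.

Lemma rnormZ r x : rnorm (r%:C *: x) = `|r| * rnorm x.
Proof.
apply: (@complexI R); rewrite -rnormE normrZ rnormE rmorphM /=.
by rewrite normc_def /= expr0n addr0 sqrtr_sqr.
Qed.

Lemma rdot_norm x : rdot x x = rnorm x ^+ 2.
Proof. by rewrite /rdot inner_norm rnormE -rmorphXn. Qed.

Lemma rdotC x y : rdot x y = rdot y x.
Proof. by rewrite /rdot innerC; case: (inner y x). Qed.

Lemma rdotDl x y z : rdot (x + y) z = rdot x z + rdot y z.
Proof. by rewrite /rdot innerDl raddfD. Qed.

Lemma rdotZl r x y : rdot (r%:C *: x) y = r * rdot x y.
Proof. by rewrite /rdot innerZl; case: (inner x y) => a b /=; rewrite mul0r subr0. Qed.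

Lemma rdotNl x y : rdot (- x) y = - rdot x y.
Proof. by rewrite /rdot linearNl raddfN. Qed.

Lemma rdotDr x y z : rdot z (x + y) = rdot z x + rdot z y.
Proof. by rewrite rdotC rdotDl !(rdotC z). Qed.

Lemma rdotZr r x y : rdot x (r%:C *: y) = r * rdot x y.
Proof. by rewrite rdotC rdotZl rdotC. Qed.

Lemma rdotNr x y : rdot x (- y) = - rdot x y.
Proof. by rewrite rdotC rdotNl rdotC. Qed.

Lemma rdotBl x y z : rdot (x - y) z = rdot x z - rdot y z.
Proof. by rewrite rdotDl rdotNl. Qed.

Lemma rdotBr x y z : rdot z (x - y) = rdot z x - rdot z y.
Proof. by rewrite rdotDr rdotNr. Qed.

Lemma rdot0l x : rdot 0 x = 0.
Proof. by rewrite -(subrr x) rdotBl subrr. Qed.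

Lemma rdot0r x : rdot x 0 = 0.
Proof. by rewrite rdotC rdot0l. Qed.

Lemma rdot_ge0 x : 0 <= rdot x x.
Proof. by rewrite rdot_norm sqr_ge0. Qed.

Lemma rdot_eq0 x : rdot x x = 0 -> x = 0.
Proof. by rewrite rdot_norm => /eqP; rewrite sqrf_eq0 rnorm_eq0 => /eqP. Qed.

Lemma rdot_inj x y : (forall z, rdot x z = rdot y z) -> x = y.
Proof.
by move=> xy; apply/eqP; rewrite -subr_eq0; apply/eqP/rdot_eq0;
  rewrite rdotBl xy subrr.
Qed.

Lemma scale_iK x : 'i *: ('i *: x) = - x.
Proof. by rewrite scalerA -expr2 sqr_i scaleN1r. Qed.

Lemma innerE x y : inner x y = rdot x y +i* rdot x ('i *: y).
Proof.
by rewrite /rdot innerZr; case: (inner x y) => a b /=; rewrite mul0r sub0r mulN1r opprK.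
Qed.

Lemma rdot_i x y : rdot ('i *: x) y = - rdot x ('i *: y).
Proof.
by rewrite /rdot innerZr innerZl; case: (inner x y) => a b /=; rewrite !mul0r; ring.
Qed.

Lemma rnorm_sqD x y : rnorm (x + y) ^+ 2 = rnorm x ^+ 2 + 2 * rdot x y + rnorm y ^+ 2.
Proof. by rewrite -!rdot_norm !(rdotDl, rdotDr) (rdotC y x); ring. Qed.

Lemma rnorm_sqB x y : rnorm (x - y) ^+ 2 = rnorm x ^+ 2 - 2 * rdot x y + rnorm y ^+ 2.
Proof. by rewrite rnorm_sqD rdotNr rnormN; ring. Qed.

Lemma rnorm_le x y : (rnorm x <= rnorm y) = (rdot x x <= rdot y y).
Proof. by rewrite !rdot_norm ler_pXn2r ?nnegrE ?rnorm_ge0. Qed.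

Lemma rnorm_parallelogram x y :
  rnorm (x + y) ^+ 2 + rnorm (x - y) ^+ 2 = 2 * (rnorm x ^+ 2 + rnorm y ^+ 2).
Proof. by rewrite rnorm_sqD rnorm_sqB; ring. Qed.

End RealStructure.
#[global] Hint Extern 0 (is_true (0 <= rnorm _)) => solve [apply: rnorm_ge0] : core.
#[global] Hint Extern 0 (is_true (0 <= rdot _ _)) => solve [apply: rdot_ge0] : core.

Section CauchySchwarz.
Context {R : realType} {H : hilbertType R}.
Implicit Types (x y z : H) (r : R).

Lemma rdot_CS x y : `|rdot x y| <= rnorm x * rnorm y.
Proof.
rewrite -ler_sqr ?nnegrE ?mulr_ge0 // exprMn -!rdot_norm.
rewrite real_normK ?num_real //; apply: CS_real => // t.
have := rdot_ge0 (x + t%:C *: y).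
by rewrite !(rdotDl, rdotDr, rdotZl, rdotZr) (rdotC y x); lra.
Qed.

Lemma rdot_le x y : rdot x y <= rnorm x * rnorm y.
Proof. exact: le_trans (ler_norm _) (rdot_CS _ _). Qed.

End CauchySchwarz.

(** * Bounded operators *)

Section BoundedOperators.
Context {R : realType} {H : hilbertType R}.
Implicit Types (S T U : H -> H) (x y z : H) (r : R).

Lemma opD T : linear T -> {morph T : x y / x + y}.
Proof. by move=> lT x y; rewrite -{1}(scale1r x) lT scale1r. Qed.

Lemma op0 T : linear T -> T 0 = 0.
Proof. by move=> lT; apply: (addIr (T 0)); rewrite -opD // !add0r. Qed.

Lemma opZ T : linear T -> forall a, {morph T : x / a *: x}.
Proof. by move=> lT a x; rewrite -[a *: x]addr0 lT op0 // addr0. Qed.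

Lemma opN T : linear T -> {morph T : x / - x}.
Proof. by move=> lT x; rewrite -scaleN1r opZ // scaleN1r. Qed.

Lemma opB T : linear T -> {morph T : x y / x - y}.
Proof. by move=> lT x y; rewrite opD // opN. Qed.

Lemma bop_lin T : bounded_op T -> linear T. Proof. by case. Qed.

Lemma bop_bound T : bounded_op T ->
  exists2 M, 0 < M & forall x, rnorm (T x) <= M * rnorm x.
Proof.
case=> _ [M hM]; exists (`|complex.Re M| + 1) => [|x]; first by rewrite ltr_wpDl.
have := hM x; rewrite !rnormE lecE => /andP[_].
have -> : complex.Re (M * (rnorm x)%:C) = complex.Re M * rnorm x.
  by case: M {hM} => a b /=; rewrite mulr0 subr0.
move=> /= /le_trans; apply; apply: ler_wpM2r => //.
by rewrite (le_trans (ler_norm _)) // lerDl.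
Qed.

Lemma bopI T M : linear T -> (forall x, rnorm (T x) <= M * rnorm x) ->
  bounded_op T.
Proof.
move=> lT hM; split=> //; exists M%:C => x.
by rewrite !rnormE -rmorphM /= lecR.
Qed.

Lemma bop_id : bounded_op (@id H).
Proof. by apply: (@bopI _ 1) => // x; rewrite mul1r. Qed.

Lemma bop_comp S T : bounded_op S -> bounded_op T -> bounded_op (S \o T).
Proof.
move=> bS bT; have [M M0 hM] := bop_bound bS; have [N N0 hN] := bop_bound bT.
apply: (@bopI _ (M * N)) => [a x y|x] /=; first by rewrite !(bop_lin bT, bop_lin bS).
by rewrite (le_trans (hM _)) // -mulrA ler_wpM2l // ltW.
Qed.

Lemma bop_add S T : bounded_op S -> bounded_op T -> bounded_op (S \+ T).
Proof.
move=> bS bT; have [M M0 hM] := bop_bound bS; have [N N0 hN] := bop_bound bT.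
apply: (@bopI _ (M + N)) => [a x y|x] /=.
  by rewrite !(bop_lin bT, bop_lin bS) scalerDr addrACA.
by rewrite (le_trans (rnormD _ _)) // mulrDl lerD.
Qed.

Lemma bop_scale a T : bounded_op T -> bounded_op (fun x => a *: T x).
Proof.
move=> [lT [M hM]]; split => [b x y|].
  by rewrite lT scalerDr !scalerA mulrC.
exists (`|a| * M) => x; rewrite normrZ -mulrA ler_wpM2l //.
Qed.

Lemma bop_sub S T : bounded_op S -> bounded_op T -> bounded_op (S \- T).
Proof.
move=> bS bT; have -> : S \- T = S \+ (fun x => -1 *: T x).
  by apply/funext => x /=; rewrite scaleN1r.
by apply: bop_add => //; exact: bop_scale.
Qed.

End BoundedOperators.

(** * Limits, closed subspaces and the Riesz representation *)

Section Limits.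
Context {R : realType} {H : hilbertType R}.
Implicit Types (T : H -> H) (u v : nat -> H) (x y z l : H) (r e : R).

(** Convergence of sequences in terms of the real-valued norm, with a weak
    inequality so that it matches the form of most estimates. *)
Definition tends u l := forall e, 0 < e ->
  exists N, forall n, (N <= n)%N -> rnorm (u n - l) <= e.

Lemma hilbert_complete u :
  (forall e, 0 < e -> exists N, forall m n, (N <= m)%N -> (N <= n)%N ->
     rnorm (u m - u n) <= e) -> exists l, tends u l.
Proof.
move=> cu.
have : cvg (u @ \oo).
  apply/cauchy_cvgP/cauchy_exP => e e0.
  have er : (complex.Re e)%:C = e by rewrite RRe_real // gtr0_real.
  have e1 : 0 < complex.Re e by rewrite -ltcR er.
  have [N hN] := cu (complex.Re e / 2) ltac:(lra).
  exists (u N); exists N => // n /= Nn.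
  rewrite -ball_normE /ball_ /= rnormE -er ltcR.
  by rewrite (le_lt_trans (hN _ _ _ _)) //; lra.
move=> /cvg_ex[l /cvgrPdist_le ul]; exists l => e e0.
have /ul [N _ hN] : 0 < e%:C by rewrite ltcR.
by exists N => n /hN; rewrite rnormE lecR rnormBC.
Qed.

Lemma tends_op T u l : bounded_op T -> tends u l -> tends (T \o u) (T l).
Proof.
move=> bT ul e e0; have [M M0 hM] := bop_bound bT.
have [|N hN] := ul (e / M); first by rewrite divr_gt0.
exists N => n /hN uN /=; rewrite -opB ?(le_trans (hM _)) //; last exact: bop_lin.
by rewrite mulrC -ler_pdivlMr.
Qed.

Lemma tends_uniq u l l' : tends u l -> tends u l' -> l = l'.
Proof.
move=> ul ul'; apply/eqP; rewrite -subr_eq0 -rnorm_eq0 eq_le rnorm_ge0 andbT.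
apply/ler_addgt0Pl => e e0; rewrite addr0.
have [N hN] := ul (e / 2) ltac:(lra); have [N' hN'] := ul' (e / 2) ltac:(lra).
have := hN (maxn N N') (leq_maxl _ _); have := hN' (maxn N N') (leq_maxr _ _).
set w := u _ => h1 h2; have -> : l - l' = (w - l') - (w - l).
  by rewrite opprB [RHS]addrC addrA subrK.
by rewrite (le_trans (rnormB _ _)) //; lra.
Qed.

Lemma tends_rnorm_le u l y r N : tends u l ->
  (forall n, (N <= n)%N -> rnorm (u n - y) <= r) -> rnorm (l - y) <= r.
Proof.
move=> ul h; apply/ler_addgt0Pr => e /ul [N' hN'].
have := h _ (leq_maxl N N'); have := hN' _ (leq_maxr N N').
set w := u _ => h1 h2; have -> : l - y = (w - y) - (w - l).
  by rewrite opprB [RHS]addrC addrA subrK.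
by rewrite (le_trans (rnormB _ _)) // lerD.
Qed.

Lemma tends_rdot_le u l y r : tends u l ->
  (forall n, rdot (u n) y <= r) -> rdot l y <= r.
Proof.
move=> ul h; apply/ler_addgt0Pr => e e0.
have [|N hN] := ul (e / (rnorm y + 1)); first by rewrite divr_gt0 // ltr_wpDl.
have -> : rdot l y = rdot (u N) y - rdot (u N - l) y by rewrite rdotBl; ring.
apply: lerD => //; rewrite -rdotNl (le_trans (rdot_le _ _)) // rnormN.
rewrite (@le_trans _ _ (e / (rnorm y + 1) * rnorm y)) //.
  by rewrite ler_wpM2r // hN.
rewrite -mulrA ler_piMr ?(ltW e0) // mulrC ler_pdivrMr ?ltr_wpDl //.
by rewrite mul1r lerDl.
Qed.

Lemma tends_rdot_eq u l y r : tends u l ->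
  (forall n, rdot (u n) y = r) -> rdot l y = r.
Proof.
move=> ul h; apply/eqP; rewrite eq_le (tends_rdot_le ul) => [|n]; last by rewrite h.
rewrite -lerN2 -rdotNr (tends_rdot_le ul) // => n; by rewrite rdotNr h.
Qed.

Lemma tends_add u v x y : tends u x -> tends v y -> tends (u \+ v) (x + y).
Proof.
move=> ux vy e e0.
have [N hN] := ux (e / 2) ltac:(lra); have [N' hN'] := vy (e / 2) ltac:(lra).
exists (maxn N N') => n; rewrite geq_max => /andP[/hN h1 /hN' h2] /=.
by rewrite opprD addrACA (le_trans (rnormD _ _)) //; lra.
Qed.

Lemma tends_shift u l : tends u l -> tends (u \o S) l.
Proof.
by move=> ul e /ul[N hN]; exists N => n Nn; apply: hN; exact: leq_trans (leqnSn _).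
Qed.

(** Closed complex subspaces; closedness is sequential. *)
Definition hsubspace (V : set H) := [/\ V 0,
  forall x y, V x -> V y -> V (x + y),
  forall a x, V x -> V (a *: x) &
  forall u l, (forall n, V (u n)) -> tends u l -> V l].

Lemma hsubspaceT : hsubspace setT.
Proof. by split. Qed.

Lemma inner_rdot0 x y : inner x y = 0 <-> rdot x y = 0 /\ rdot x ('i *: y) = 0.
Proof. by rewrite innerE; split => [[]//|[-> ->]]. Qed.

Lemma rnormi x : rnorm ('i *: x) = rnorm x.
Proof.
rewrite /rnorm normrZ normc_def /= expr0n expr1n add0r sqrtr1.
by rewrite -[RHS]/(complex.Re `|x|) mul1r.
Qed.

Lemma hsubspace_ortho F : hsubspace (Defs.ortho F).
Proof.
split=> [y _|x y hx hy z Fz|a x hx y Fy|u l hu ul y Fy].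
- exact: linear0l.
- by rewrite innerDl hx // hy // addr0.
- by rewrite innerZl hx // mulr0.
- apply/inner_rdot0; split; apply: (tends_rdot_eq ul) => n;
  by have /inner_rdot0[] := hu n y Fy.
Qed.

Lemma hsubspace_ker T : bounded_op T -> hsubspace [set x | T x = 0].
Proof.
move=> bT; have lT := bop_lin bT; split=> /= [|x y hx hy|a x hx|u l hu ul].
- exact: op0.
- by rewrite opD // hx hy addr0.
- by rewrite opZ // hx scaler0.
- apply: (tends_uniq (tends_op bT ul)) => e e0; exists 0 => n _ /=.
  by rewrite hu subr0 rnorm0 ltW.
Qed.

(** The Riesz representation of a bounded real-linear functional on a closed
    subspace. Applied to [rdot x] it gives the orthogonal projection of [x], and
    applied to [x |-> rdot (T x) y] on the whole space it gives the adjoint. The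
    representing vector minimizes [|x|^2 - 2 phi x]; minimizing sequences are
    Cauchy by the parallelogram law. *)
Lemma riesz_subspace (V : set H) (phi : H -> R) (c : R) : hsubspace V ->
  {morph phi : x y / x + y} -> (forall r x, phi (r%:C *: x) = r * phi x) ->
  (forall x, phi x <= c * rnorm x) ->
  exists2 v, V v & forall w, V w -> rdot v w = phi w.
Proof.
move=> [V0 VD VZ Vcl] phiD phiZ phic.
(* F x is |x - v|^2 up to a constant, with v the representing vector. *)
pose F x := rnorm x ^+ 2 - 2 * phi x.
have Flb x : - c ^+ 2 <= F x.
  have := phic x; have := sqr_ge0 (rnorm x - c); rewrite /F sqrrB; lra.
pose E := F @` V.
have hE : has_inf E.
  by split; [exists (F 0), 0|exists (- c ^+ 2) => _ [x _ <-]].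
pose d := inf E.
have dF x : V x -> d <= F x.
  by move=> Vx; apply: inf_lbound; [case: hE|exists x].
have /choice[u hu] n : exists x, V x /\ F x < d + n.+1%:R^-1.
  have [_ [x Vx <-] ?] := @inf_adherent _ E n.+1%:R^-1 (ltac:(by rewrite invr_gt0)) hE.
  by exists x.
have uV n : V (u n) by case: (hu n).
have uF n : F (u n) < d + n.+1%:R^-1 by case: (hu n).
have Fcomb x y : F x + F y = 2 * F ((2^-1)%:C *: (x + y)) + rnorm (x - y) ^+ 2 / 2.
  have := rnorm_parallelogram x y; rewrite /F rnormZ phiZ phiD.
  rewrite ger0_norm ?invr_ge0 // exprMn; lra.
have [|l ul] := @hilbert_complete u.
  move=> e e0; have e4 : 0 < e ^+ 2 / 4 by rewrite divr_gt0 // exprn_gt0.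
  have [N hN] := invS_small e4.
  exists N => m n /hN hm /hN hn.
  rewrite -ler_sqr ?nnegrE ?(ltW e0) ?rnorm_ge0 //.
  have := Fcomb (u m) (u n).
  have := dF _ (VZ (2^-1)%:C _ (VD _ _ (uV m) (uV n))).
  move: (uF m) (uF n) hm hn.
  move: (F _) (F _) (F _) (rnorm _) (_.+1%:R^-1) (_.+1%:R^-1) => *. lra.
exists l => [|w Vw]; first exact: Vcl ul.
apply/eqP; rewrite -subr_eq0 -normr_eq0 eq_le normr_ge0 andbT.
apply/ler_addgt0Pl => e e0; rewrite addr0.
pose k := rnorm w + 1; have k0 : 0 < k by rewrite ltr_wpDl.
have [N hN] := @invS_small R ((e / 2 / k) ^+ 2) ltac:(by rewrite exprn_gt0 // !divr_gt0).
have [N' hN'] := ul (e / 2 / k) ltac:(by rewrite !divr_gt0).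
pose n := maxn N N'; have := hN n (leq_maxl _ _); have := hN' n (leq_maxr _ _).
move=> h1 h2.
(* First variation of F at the approximate minimizer u n, in the direction w. *)
have gn : (rdot (u n) w - phi w) ^+ 2 <= (e / 2) ^+ 2.
  have : (rdot (u n) w - phi w) ^+ 2 <= (e / 2 / k) ^+ 2 * rnorm w ^+ 2.
    apply: CS_real; rewrite ?sqr_ge0 // => t.
    have := dF _ (VD _ _ (uV n) (VZ t%:C _ Vw)); have := uF n.
    rewrite /F rnorm_sqD phiD phiZ rnormZ rdotZr exprMn real_normK ?num_real //.
    move: h2; move: (rnorm _) (rnorm _) (phi _) (phi _) (rdot _ _) (_.+1%:R^-1) (_ / _ / _).
    by move=> *; lra.
  move=> /le_trans; apply; rewrite -exprMn.
  rewrite ler_sqr ?nnegrE ?mulr_ge0 ?rnorm_ge0 ?invr_ge0 ?(ltW k0) ?(ltW e0) //.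
  rewrite -[e / 2 / k * _]mulrA ler_piMr ?divr_ge0 ?(ltW e0) // mulrC ler_pdivrMr // mul1r.
  by rewrite lerDl.
have {}gn : `|rdot (u n) w - phi w| <= e / 2.
  by rewrite -ler_sqr ?nnegrE ?divr_ge0 ?(ltW e0) // real_normK ?num_real.
have -> : rdot l w - phi w = (rdot (u n) w - phi w) - rdot (u n - l) w.
  by rewrite rdotBl; ring.
rewrite (le_trans (ler_normB _ _)) //.
have : `|rdot (u n - l) w| <= e / 2.
  rewrite (le_trans (rdot_CS _ _)) // (le_trans (ler_wpM2r _ h1)) //.
  rewrite -[e / 2 / k * _]mulrA ler_piMr ?divr_ge0 ?(ltW e0) // mulrC ler_pdivrMr // mul1r.
  by rewrite lerDl.
by move: gn; lra.
Qed.

End Limits.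

(** * Orthogonal projections and adjoints *)

Section Adjoint.
Context {R : realType} {H : hilbertType R}.
Implicit Types (S T U : H -> H) (V : set H) (x y z w : H) (r : R).

(** The orthogonal projection, specified by the inner products with the elements of
    the subspace: this determines it and makes it linear. *)
Lemma proj_exists V : hsubspace V -> exists P : H -> H,
  [/\ bounded_op P, forall x, V (P x) & forall x w, V w -> inner (P x) w = inner x w].
Proof.
move=> cV; have [V0 VD VZ _] := cV.
have /choice[P hP] x : exists v, V v /\ forall w, V w -> rdot v w = rdot x w.
  have [] := @riesz_subspace _ _ V (rdot x) (rnorm x) cV.
  - by move=> y z; rewrite rdotDr.
  - by move=> r y; rewrite rdotZr.
  - by move=> y; exact: rdot_le.
  by move=> v Vv hv; exists v.
have VP x : V (P x) by case: (hP x).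
have iP x w : V w -> inner (P x) w = inner x w.
  move=> Vw; have [_ h] := hP x; rewrite [LHS]innerE [RHS]innerE !h //.
  exact: VZ.
exists P; split => //; apply: (@bopI _ _ _ 1) => [a x y|x].
  pose v := P (a *: x + y) - (a *: P x + P y).
  have Vv : V v.
    by rewrite /v -scaleN1r; apply: (VD) => //; apply: (VZ); apply: (VD) => //; apply: (VZ).
  have : rdot v v = 0.
    by rewrite /rdot {1}/v innerBl innerDl innerZl !iP // innerDl innerZl subrr.
  by move/rdot_eq0/eqP; rewrite subr_eq0 => /eqP.
rewrite mul1r; have : rdot (P x) (P x) <= rnorm x * rnorm (P x).
  by rewrite {1}/rdot iP //; exact: rdot_le.
rewrite rdot_norm expr2; have [->//|Px0] := eqVneq (rnorm (P x)) 0.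
by rewrite ler_pM2r // lt_neqAle eq_sym Px0 /=.
Qed.

Lemma adjoint_exists T : bounded_op T -> exists S : H -> H,
  bounded_op S /\ forall x y, inner (T x) y = inner x (S y).
Proof.
move=> bT; have lT := bop_lin bT; have [M M0 hM] := bop_bound bT.
have /choice[S hS] y : exists v, forall w, rdot v w = rdot (T w) y.
  have [] := @riesz_subspace _ _ setT (fun w => rdot (T w) y) (M * rnorm y)
    (hsubspaceT).
  - by move=> u w; rewrite opD // rdotDl.
  - by move=> r u; rewrite opZ // rdotZl.
  - by move=> w; rewrite (le_trans (rdot_le _ _)) // mulrAC ler_wpM2r.
  by move=> v _ hv; exists v => w; apply: hv.
have rS x y : rdot (T x) y = rdot x (S y) by rewrite -hS rdotC.
have iS x y : inner (T x) y = inner x (S y).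
  rewrite !innerE rS; congr (_ +i* _).
  by apply: oppr_inj; rewrite -!rdot_i -opZ // rS.
exists S; split=> //; apply: (@bopI _ _ _ M) => [a x y|y].
  apply: rdot_inj => z; rewrite rdotC -rS rdotC /rdot.
  have ciS x' y' : inner (S x') y' = inner x' (T y') by rewrite innerC -iS -innerC.
  by rewrite !(innerDl, innerZl) !ciS.
have : rdot (S y) (S y) <= (M * rnorm y) * rnorm (S y).
  rewrite -rS (le_trans (rdot_le _ _)) // mulrAC ler_wpM2r //.
rewrite rdot_norm expr2; have [->|Px0] := eqVneq (rnorm (S y)) 0.
  by rewrite mulr_ge0 // ltW.
by rewrite ler_pM2r // lt_neqAle eq_sym Px0 /=.
Qed.

Lemma adjoint_opP T : bounded_op T -> bounded_op (adjoint_op T) /\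
  forall x y, inner (T x) y = inner x (adjoint_op T y).
Proof. by move=> /adjoint_exists; apply: getPex. Qed.

Lemma adjoint_op_eq T S : bounded_op T ->
  (forall x y, inner (T x) y = inner x (S y)) -> adjoint_op T = S.
Proof.
move=> /adjoint_opP[_ h] hS; apply/funext => y; apply: rdot_inj => z.
by rewrite rdotC /rdot -h hS -!/(rdot _ _) rdotC.
Qed.

Lemma rdot_adj T x y : bounded_op T -> rdot (T x) y = rdot x (adjoint_op T y).
Proof. by move=> /adjoint_opP[_ h]; rewrite /rdot h. Qed.

Lemma rdot_adjl T x y : bounded_op T -> rdot (adjoint_op T x) y = rdot x (T y).
Proof. by move=> bT; rewrite rdotC -rdot_adj // rdotC. Qed.

Lemma adjoint_bop T : bounded_op T -> bounded_op (adjoint_op T).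
Proof. by case/adjoint_opP. Qed.

End Adjoint.

(** * Positive operators *)

Section Positive.
Context {R : realType} {H : hilbertType R}.
Implicit Types (S T U : H -> H) (V : set H) (x y z w : H) (r : R).

Lemma positive_bop T : positive_op T -> bounded_op T. Proof. by case. Qed.

Lemma positive_ge0 T x : positive_op T -> 0 <= rdot (T x) x.
Proof. by case=> _ /(_ x); rewrite innerE lecE => /andP[_]. Qed.

Lemma positive_im T x : positive_op T -> rdot (T x) ('i *: x) = 0.
Proof. by case=> _ /(_ x); rewrite innerE lecE => /andP[/eqP]. Qed.

(** Polarization: the quadratic form of [T] is real at [x + 'i *: y]. *)
Lemma positive_sa T x y : positive_op T -> rdot (T x) y = rdot x (T y).
Proof.
move=> pT; have lT := bop_lin (positive_bop pT).
have := positive_im (x + 'i *: y) pT.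
rewrite opD // opZ // scalerDr scale_iK.
rewrite !(rdotDl, rdotDr, rdotNr, rdot_i) positive_im // scale_iK !rdotNr positive_im //.
by rewrite (rdotC (T y) x); lra.
Qed.

Lemma positive_innerC T x y : positive_op T -> inner (T x) y = inner x (T y).
Proof.
move=> pT; rewrite !innerE positive_sa // positive_sa //.
by rewrite (opZ (bop_lin (positive_bop pT))).
Qed.

Lemma positiveI T : bounded_op T -> (forall x y, rdot (T x) y = rdot x (T y)) ->
  (forall x, 0 <= rdot (T x) x) -> positive_op T.
Proof.
move=> bT sT pT; split=> // x; rewrite innerE lecE /= pT andbT; apply/eqP.
have := sT x ('i *: x); rewrite (opZ (bop_lin bT)).
by rewrite -(opprK (rdot x _)) -rdot_i rdotC; lra.
Qed.

Lemma positive_CS T x y : positive_op T ->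
  rdot (T x) y ^+ 2 <= rdot (T x) x * rdot (T y) y.
Proof.
move=> pT; apply: CS_real; rewrite ?positive_ge0 // => t.
have := positive_ge0 (x + t%:C *: y) pT.
have lT := bop_lin (positive_bop pT).
rewrite opD // opZ // !(rdotDl, rdotDr, rdotZl, rdotZr) (positive_sa y x) // (rdotC y (T x)).
by lra.
Qed.

(** Cauchy-Schwarz for the form of [T], at [x] and [T x]: approximate zeros of the
    quadratic form are approximate zeros of the operator. *)
Lemma positive_sq_le T M x : positive_op T -> (forall x, rnorm (T x) <= M * rnorm x) ->
  rnorm (T x) ^+ 2 <= M * rdot (T x) x.
Proof.
move=> pT hM; have := positive_CS x (T x) pT; rewrite rdot_norm.
have h : rdot (T (T x)) (T x) <= M * rnorm (T x) ^+ 2.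
  by rewrite (le_trans (rdot_le _ _)) // expr2 mulrA ler_wpM2r.
have [->|n0] := eqVneq (rnorm (T x)) 0.
  move=> _; rewrite expr0n /=.
  have [->|x0] := eqVneq x 0; first by rewrite rdot0r mulr0.
  rewrite mulr_ge0 ?positive_ge0 //.
  by have := le_trans (rnorm_ge0 _) (hM x); rewrite pmulr_lge0 // rnorm_gt0.
have n1 : 0 < rnorm (T x) ^+ 2 by rewrite exprn_gt0 // lt_neqAle eq_sym n0 /=.
move=> /le_trans/(_ (ler_wpM2l (positive_ge0 x pT) h)) h2.
by rewrite -(ler_pM2r n1) -expr2 (le_trans h2) // mulrCA mulrA.
Qed.

Lemma positive_contraction T x : positive_op T ->
  (forall x, rdot (T x) x <= rnorm x ^+ 2) -> rnorm (T x) <= rnorm x.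
Proof.
move=> pT hT; have := positive_CS x (T x) pT; rewrite rdot_norm => h.
have [->//|n0] := eqVneq (rnorm (T x)) 0.
have n1 : 0 < rnorm (T x) ^+ 2 by rewrite exprn_gt0 // lt_neqAle eq_sym n0 /=.
rewrite -ler_sqr ?nnegrE // -(ler_pM2r n1) -expr2 (le_trans h) //.
by apply: ler_pM => //; exact: positive_ge0.
Qed.

Lemma positive_eq0 T x : positive_op T -> rdot (T x) x = 0 -> T x = 0.
Proof.
move=> pT x0; have [M _ hM] := bop_bound (positive_bop pT).
have := positive_sq_le x pT hM; rewrite x0 mulr0 -rdot_norm => h.
by apply: rdot_eq0; apply/eqP; rewrite eq_le h /=.
Qed.

Lemma positive_comp_adj T : bounded_op T -> positive_op (adjoint_op T \o T).
Proof.
move=> bT; apply: positiveI => [|x y|x] /=.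
- by apply: bop_comp => //; exact: adjoint_bop.
- by rewrite rdot_adjl // rdot_adj.
- by rewrite rdot_adjl.
Qed.

Lemma positive_adj T : positive_op T -> adjoint_op T = T.
Proof.
move=> pT; apply: adjoint_op_eq => [|x y]; first exact: positive_bop.
exact: positive_innerC.
Qed.

(** The square root is operator monotone. If [T - S] had a negative lower bound
    [- d], attained approximately at a unit vector [x], then [S x] would be
    close to [T x + d x], which is strictly longer than [T x] because [T] is
    positive. *)
Lemma sqrt_monotone S T : positive_op S -> positive_op T ->
  (forall x, rnorm (S x) <= rnorm (T x)) -> forall x, rdot (S x) x <= rdot (T x) x.
Proof.
move=> pS pT ST x0; rewrite leNgt; apply/negP => lt0.
have bS := positive_bop pS; have bT := positive_bop pT.
have lS := bop_lin bS; have lT := bop_lin bT.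
have [M M0 hM] := bop_bound bS; have [N N0 hN] := bop_bound bT.
pose q x := rdot (T x) x - rdot (S x) x.
have qZ r x : q (r%:C *: x) = r ^+ 2 * q x.
  by rewrite /q !opZ // !(rdotZl, rdotZr); ring.
pose E := [set q x | x in [set x | rnorm x = 1]].
have qlb x : rnorm x = 1 -> - M <= q x.
  move=> x1; rewrite /q lerBrDl (le_trans _ (positive_ge0 x pT)) // subr_le0.
  by rewrite (le_trans (rdot_le _ _)) // x1 mulr1 (le_trans (hM x)) // x1 mulr1.
have nx0 : 0 < rnorm x0.
  by rewrite rnorm_gt0; apply: contraTneq lt0 => ->; rewrite !rdot0r ltxx.
have n1 x : 0 < rnorm x -> rnorm ((rnorm x)^-1%:C *: x) = 1.
  by move=> nx; rewrite rnormZ ger0_norm ?invr_ge0 // mulVf // gt_eqF.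
have hE : has_inf E.
  split.
    exists (q ((rnorm x0)^-1%:C *: x0)), ((rnorm x0)^-1%:C *: x0) => //.
    exact: n1.
  by exists (- M) => _ [x /= x1 <-]; exact: qlb.
pose d := - inf E.
have hd x : - d * rnorm x ^+ 2 <= q x.
  have [->|] := eqVneq x 0; first by rewrite rnorm0 /q !rdot0r subrr expr0n mulr0.
  rewrite -rnorm_gt0 => nx.
  have : inf E <= q ((rnorm x)^-1%:C *: x).
    by apply: inf_lbound; [case: hE|exists ((rnorm x)^-1%:C *: x) => //; exact: n1].
  by rewrite qZ exprVn mulrC ler_pdivlMr ?exprn_gt0 // /d opprK.
have d0 : 0 < d.
  have := hd x0; rewrite /q => h; have : - d * rnorm x0 ^+ 2 < 0.
    by rewrite (le_lt_trans h) // subr_lt0.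
  by rewrite mulNr oppr_lt0 pmulr_lgt0 // exprn_gt0.
(* The best lower bound of T - S is - d, so D is positive, and it nearly
   vanishes where that bound is nearly attained. *)
pose D x := (T x - S x) + d%:C *: x.
have bD : bounded_op D.
  apply: (bop_add (bop_sub bT bS)); apply: bop_scale; exact: bop_id.
have Dq x : rdot (D x) x = q x + d * rnorm x ^+ 2.
  by rewrite /D rdotDl rdotBl rdotZl rdot_norm.
have pD : positive_op D.
  apply: positiveI => // [x y|x]; last by rewrite Dq; have := hd x; lra.
  rewrite /D !(rdotDl, rdotDr, rdotNl, rdotNr, rdotZl, rdotZr).
  by rewrite (positive_sa x y pS) (positive_sa x y pT).
have [L L0 hL] := bop_bound bD.
suff : d ^+ 2 <= 0 by rewrite leNgt exprn_gt0.
apply: (@small_le0 _ _ (M + N + d / L)) => [|e e0 e1].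
  by rewrite !addr_gt0 // divr_gt0.
have eL : 0 < e ^+ 2 / L by rewrite divr_gt0 // exprn_gt0.
have [_ [x /= x1 <-] qx] := inf_adherent eL hE.
have rD : rnorm (D x) <= e.
  rewrite -ler_sqr ?nnegrE ?(ltW e0) // (le_trans (positive_sq_le x pD hL)) //.
  rewrite Dq x1 expr1n mulr1 mulrC -ler_pdivlMr //.
  by move: qx; rewrite -(opprK (inf E)) -/d; lra.
(* From <(S + T) x, (S - T) x> = |S x|^2 - |T x|^2 <= 0, with
   (S - T) x = d x - D x. *)
have key : d * (rdot (S x) x + rdot (T x) x) <= (M + N) * e.
  have h1 : rdot (S x + T x) (S x - T x) <= 0.
    rewrite !(rdotDl, rdotBr) (rdotC (T x) (S x)).
    by have := ST x; rewrite rnorm_le; lra.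
  have h2 : rdot (S x + T x) (D x) <= (M + N) * e.
    rewrite (le_trans (rdot_le _ _)) // ler_pM // (le_trans (rnormD _ _)) //.
    by rewrite lerD // -[leRHS]mulr1 -x1.
  have -> : d * (rdot (S x) x + rdot (T x) x) =
     rdot (S x + T x) (D x) + rdot (S x + T x) (S x - T x).
    by rewrite /D !(rdotDl, rdotDr, rdotNr, rdotZr); ring.
  by lra.
have h3 : d - e ^+ 2 / L <= rdot (S x) x.
  move: qx; rewrite /q -(opprK (inf E)) -/d; have := positive_ge0 x pT; lra.
have : d * (d - e ^+ 2 / L) <= (M + N) * e.
  rewrite (le_trans _ key) // ler_pM2l // (le_trans h3) // lerDl.
  exact: positive_ge0.
rewrite mulrBr -expr2 => h4.
have : d * (e ^+ 2 / L) <= d / L * e.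
  rewrite mulrA mulrAC ler_pM2l ?divr_gt0 // expr2 ler_piMr // ltW //.
lra.
Qed.

Lemma positive_norm_uniq S T : positive_op S -> positive_op T ->
  (forall x, rnorm (S x) = rnorm (T x)) -> S = T.
Proof.
move=> pS pT nST.
have qST x : rdot (S x) x = rdot (T x) x.
  by apply/eqP; rewrite eq_le !sqrt_monotone // => y; rewrite nST.
have bS := positive_bop pS; have bT := positive_bop pT.
have pD : positive_op (S \- T).
  apply: positiveI => [|x y|x] /=; first exact: bop_sub.
    by rewrite rdotBl rdotBr !positive_sa.
  by rewrite rdotBl qST subrr.
apply/funext => x; apply/eqP; rewrite -subr_eq0; apply/eqP.
by apply: (positive_eq0 pD); rewrite /= rdotBl qST subrr.
Qed.

Lemma positive_sqrt_uniq S T : positive_op S -> positive_op T -> S \o S = T \o T -> S = T.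
Proof.
move=> pS pT ST; apply: positive_norm_uniq => // x; apply/eqP.
rewrite -(@eqrXn2 _ 2) ?rnorm_ge0 // -!rdot_norm -!positive_sa //.
by rewrite -[S (S x)]/((S \o S) x) ST.
Qed.

End Positive.

(** * Square roots and moduli *)

Section SquareRoot.
Context {R : realType} {H : hilbertType R}.
Implicit Types (S T U W Q : H -> H) (V : set H) (x y z w : H) (r : R).

Section Iteration.
Variable X : H -> H.
Hypothesis pX : positive_op X.
Hypothesis X1 : forall x, rnorm (X x) <= rnorm x.

Let half : R[i] := (2^-1 : R)%:C.

(** The solution [Z] of [(1 - Z)^2 = 1 - X] is the fixed point of
    [Z |-> (X + Z^2) / 2], reached by iteration from [0]. *)
Fixpoint sqrt_iter n : H -> H :=
  if n is m.+1 then fun x => half *: (X x + sqrt_iter m (sqrt_iter m x))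
  else fun=> 0.

(** The same iteration for the number [X = 1]; it dominates the operator iteration
    and its increments because [sqrt_iter n] is a polynomial in [X] with nonnegative
    coefficients. *)
Fixpoint sqrt_bound n : R :=
  if n is m.+1 then (1 + sqrt_bound m ^+ 2) / 2 else 0.

Lemma sqrt_bound01 n : 0 <= sqrt_bound n <= 1.
Proof.
elim: n => [|n /andP[h0 h1]] /=; first by rewrite lexx ler01.
have : sqrt_bound n ^+ 2 <= 1 by rewrite expr_le1.
by have := sqr_ge0 (sqrt_bound n); lra.
Qed.

Lemma sqrt_bound_ge0 n : 0 <= sqrt_bound n.
Proof. by case/andP: (sqrt_bound01 n). Qed.

Lemma sqrt_bound_incr n : sqrt_bound n <= sqrt_bound n.+1.
Proof. by rewrite /=; have := sqr_ge0 (sqrt_bound n - 1); lra. Qed.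

Lemma sqrt_bound_mono m n : (m <= n)%N -> sqrt_bound m <= sqrt_bound n.
Proof.
elim: n => [|n IH]; first by rewrite leqn0 => /eqP ->.
rewrite leq_eqVlt => /orP[/eqP -> //|/IH /le_trans]; apply.
exact: sqrt_bound_incr.
Qed.

Lemma half_norm x : rnorm (half *: x) = rnorm x / 2.
Proof. by rewrite rnormZ ger0_norm ?invr_ge0 // mulrC. Qed.

Lemma sqrt_iter_lin n : linear (sqrt_iter n).
Proof.
have lX := bop_lin (positive_bop pX).
elim: n => [|n IH] a x y /=; first by rewrite scaler0 addr0.
rewrite lX !IH [in RHS]scalerA (mulrC a) -[in RHS]scalerA -[RHS]scalerDr.
by rewrite addrACA -scalerDr.
Qed.

Lemma sqrt_iter_norm n x : rnorm (sqrt_iter n x) <= sqrt_bound n * rnorm x.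
Proof.
elim: n x => [|n IH] x /=; first by rewrite rnorm0 mul0r.
rewrite half_norm mulrAC ler_pM2r ?invr_gt0 // (le_trans (rnormD _ _)) //.
rewrite mulrDl mul1r lerD // (le_trans (IH _)) // expr2 -mulrA ler_wpM2l //.
exact: sqrt_bound_ge0.
Qed.

Lemma sqrt_iter_contr n x : rnorm (sqrt_iter n x) <= rnorm x.
Proof.
rewrite (le_trans (sqrt_iter_norm n x)) // ler_piMl //.
by case/andP: (sqrt_bound01 n).
Qed.

Lemma sqrt_iter_sa n x y : rdot (sqrt_iter n x) y = rdot x (sqrt_iter n y).
Proof.
elim: n x y => [|n IH] x y /=; first by rewrite rdot0l rdot0r.
by rewrite rdotZl rdotZr rdotDl rdotDr !IH positive_sa.
Qed.

Lemma sqrt_iter_commX n Z : linear Z -> (forall x, X (Z x) = Z (X x)) ->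
  forall x, sqrt_iter n (Z x) = Z (sqrt_iter n x).
Proof.
move=> lZ XZ; elim: n => [|n IH] x /=; first by rewrite op0.
by rewrite (opZ lZ) (opD lZ) XZ !IH.
Qed.

Lemma sqrt_iter_comm m n x : 
  sqrt_iter m (sqrt_iter n x) = sqrt_iter n (sqrt_iter m x).
Proof.
apply: sqrt_iter_commX => [|y]; first exact: sqrt_iter_lin.
by rewrite sqrt_iter_commX //; exact/bop_lin/positive_bop.
Qed.

(** The iterates commute, so the difference of two squares factors. *)
Lemma sqrt_iter_step n x : rnorm (sqrt_iter n.+1 x - sqrt_iter n x) <=
  (sqrt_bound n.+1 - sqrt_bound n) * rnorm x.
Proof.
elim: n x => [|n IH] x.
  rewrite /= !subr0 addr0 half_norm expr0n /= addr0 mul1r mulrC.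
  by rewrite ler_wpM2l ?invr_ge0.
pose y := sqrt_iter n.+1 x + sqrt_iter n x.
have -> : sqrt_iter n.+2 x - sqrt_iter n.+1 x =
    half *: (sqrt_iter n.+1 y - sqrt_iter n y).
  rewrite /y !(opD (sqrt_iter_lin _)) (sqrt_iter_comm n n.+1).
  rewrite -[sqrt_iter n.+2 x]/(half *: (X x + _)).
  rewrite -[sqrt_iter n.+1 x in X in _ - X]/(half *: (X x + _)).
  rewrite -scalerBr; congr (_ *: _).
  by apply: rdot_inj => w; rewrite !(rdotDl, rdotNl); ring.
rewrite half_norm ler_pdivrMr //.
rewrite (le_trans (IH y)) //.
have h : rnorm y <= (sqrt_bound n.+1 + sqrt_bound n) * rnorm x.
  by rewrite (le_trans (rnormD _ _)) // mulrDl lerD // sqrt_iter_norm.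
rewrite (le_trans (ler_wpM2l _ h)) ?subr_ge0 ?sqrt_bound_incr //.
have -> : sqrt_bound n.+2 - sqrt_bound n.+1 =
    (sqrt_bound n.+1 - sqrt_bound n) * (sqrt_bound n.+1 + sqrt_bound n) / 2.
  by rewrite -[sqrt_bound n.+2]/((1 + sqrt_bound n.+1 ^+ 2) / 2)
    -[sqrt_bound n.+1 in X in _ - X]/((1 + sqrt_bound n ^+ 2) / 2); field.
by move: (sqrt_bound n.+1) (sqrt_bound n) => *; lra.
Qed.

Lemma sqrt_iter_dist m n x : (m <= n)%N ->
  rnorm (sqrt_iter n x - sqrt_iter m x) <= (sqrt_bound n - sqrt_bound m) * rnorm x.
Proof.
elim: n => [|n IH]; first by rewrite leqn0 => /eqP ->; rewrite !subrr rnorm0 mul0r.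
rewrite leq_eqVlt => /orP[/eqP ->|/IH h]; first by rewrite !subrr rnorm0 mul0r.
have -> : sqrt_iter n.+1 x - sqrt_iter m x =
  (sqrt_iter n.+1 x - sqrt_iter n x) + (sqrt_iter n x - sqrt_iter m x).
  by rewrite addrA subrK.
rewrite (le_trans (rnormD _ _)) // (le_trans (lerD (sqrt_iter_step _ _) h)) //.
by rewrite -mulrDl addrA subrK.
Qed.

Lemma sqrt_iter_cvg x : exists l, tends (sqrt_iter^~ x) l.
Proof.
apply: hilbert_complete => e e0.
pose E := range sqrt_bound.
have hE : has_sup E.
  split; first by exists (sqrt_bound 0), 0.
  by exists 1 => _ [n _ <-]; case/andP: (sqrt_bound01 n).
pose k := rnorm x + 1; have k0 : 0 < k by rewrite ltr_wpDl.
have [_ [N _ <-] hN] := sup_adherent (divr_gt0 e0 k0) hE.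
have key m n : (N <= m)%N -> (m <= n)%N -> rnorm (sqrt_iter n x - sqrt_iter m x) <= e.
  move=> Nm mn; rewrite (le_trans (sqrt_iter_dist _ mn)) //.
  have h1 := sqrt_bound_mono Nm.
  have h2 : sqrt_bound n <= sup E by apply: ub_le_sup; [case: hE|exists n].
  rewrite (@le_trans _ _ (e / k * rnorm x)) // ?ler_wpM2r //; first lra.
  by rewrite -mulrA ler_piMr ?(ltW e0) // mulrC ler_pdivrMr // mul1r lerDl.
exists N => m n Nm Nn; case: (leqP m n) => [mn|/ltnW mn]; last exact: key.
by rewrite rnormBC; exact: key.
Qed.

Lemma sqrt_iter_limit : exists Z : H -> H,
  [/\ linear Z, forall x, rnorm (Z x) <= rnorm x,
      forall x y, rdot (Z x) y = rdot x (Z y) &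
      forall x, Z x = half *: (X x + Z (Z x))].
Proof.
have /choice[Z hZ] := sqrt_iter_cvg.
have lZ : linear Z.
  move=> a x y; apply: (tends_uniq (hZ _)).
  have -> : sqrt_iter^~ (a *: x + y) = (fun n => a *: sqrt_iter n x) \+ sqrt_iter^~ y.
    by apply/funext => n /=; rewrite sqrt_iter_lin.
  apply: tends_add => //.
  exact: (@tends_op _ _ (fun z => a *: z) _ _ (bop_scale _ (@bop_id _ _))).
have nZ x : rnorm (Z x) <= rnorm x.
  rewrite -[Z x]subr0; apply: (tends_rnorm_le (N := 0) (hZ x)) => n _.
  by rewrite subr0 sqrt_iter_contr.
have bZ : bounded_op Z by apply: (@bopI _ _ _ 1) => // x; rewrite mul1r.
exists Z; split => // [x y|x].
- apply/eqP; rewrite -subr_eq0 -normr_eq0 eq_le normr_ge0 andbT.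
  apply/(@small_le0 _ _ (rnorm y + rnorm x + 1)) => [|e e0 e1].
    by rewrite ltr_wpDl // addr_ge0.
  have [N hN] := hZ x _ e0; have [N' hN'] := hZ y _ e0.
  pose n := maxn N N'; have := hN n (leq_maxl _ _); have := hN' n (leq_maxr _ _).
  move=> h1 h2; have -> : rdot (Z x) y - rdot x (Z y) =
    rdot x (sqrt_iter n y - Z y) - rdot (sqrt_iter n x - Z x) y.
    by rewrite rdotBl rdotBr sqrt_iter_sa; ring.
  rewrite (le_trans (ler_normB _ _)) // (@le_trans _ _ (rnorm x * e + e * rnorm y)) //.
    by rewrite lerD // (le_trans (rdot_CS _ _)) // ?ler_wpM2l // ler_wpM2r.
  lra.
- apply: (tends_uniq (tends_shift (hZ x))).
  have -> : (sqrt_iter^~ x \o S) = (fun n => half *: (X x + sqrt_iter n (sqrt_iter n x))).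
    by apply/funext.
  apply: (@tends_op _ _ (fun z => half *: z) _ _ (bop_scale _ (@bop_id _ _))).
  apply: tends_add => [e e0|e e0]; first by exists 0 => n _; rewrite subrr rnorm0 ltW.
  have [N hN] := hZ x (e / 2) ltac:(lra); have [N' hN'] := hZ (Z x) (e / 2) ltac:(lra).
  exists (maxn N N') => n; rewrite geq_max => /andP[/hN h1 /hN' h2] /=.
  have -> : sqrt_iter n (sqrt_iter n x) - Z (Z x) =
    sqrt_iter n (sqrt_iter n x - Z x) + (sqrt_iter n (Z x) - Z (Z x)).
    by rewrite (opB (sqrt_iter_lin _)) addrA subrK.
  rewrite (le_trans (rnormD _ _)) // (le_trans (lerD (sqrt_iter_contr _ _) h2)) //.
  lra.
Qed.

End Iteration.

(** The iteration is applied to [X = 1 - W / M], where [M] bounds [W]. *)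
Lemma sqrt_exists W : positive_op W -> exists Q : H -> H, positive_op Q /\ Q \o Q = W.
Proof.
move=> pW; have bW := positive_bop pW; have lW := bop_lin bW.
have [M M0 hM] := bop_bound bW.
pose X x := x - (M^-1)%:C *: W x.
have bX : bounded_op X by apply: bop_sub; [exact: bop_id|exact: bop_scale].
have qX x : rdot (X x) x = rnorm x ^+ 2 - M^-1 * rdot (W x) x.
  by rewrite /X rdotBl rdotZl rdot_norm.
have pX : positive_op X.
  apply: positiveI => // [x y|x].
    by rewrite /X rdotBl rdotBr rdotZl rdotZr positive_sa.
  rewrite qX subr_ge0 mulrC ler_pdivrMr // (le_trans (rdot_le _ _)) //.
  by rewrite (le_trans (ler_wpM2r _ (hM x))) // expr2 -mulrA mulrC.
have X1 x : rnorm (X x) <= rnorm x.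
  apply: positive_contraction => // y; rewrite qX gerBl mulr_ge0 ?invr_ge0 ?(ltW M0) //.
  exact: positive_ge0.
have [Z [lZ nZ sZ eZ]] := sqrt_iter_limit pX X1.
pose c : R := Num.sqrt M.
have bZ : bounded_op Z by apply: (@bopI _ _ _ 1) => // x; rewrite mul1r.
pose Q x := c%:C *: (x - Z x).
have bQ : bounded_op Q.
  by apply: bop_scale; apply: bop_sub => //; exact: bop_id.
exists Q; split.
  apply: positiveI => // [x y|x].
    by rewrite /Q rdotZl rdotZr rdotBl rdotBr sZ.
  rewrite /Q rdotZl mulr_ge0 ?sqrtr_ge0 // rdotBl subr_ge0 rdot_norm.
  by rewrite (le_trans (rdot_le _ _)) // expr2 ler_wpM2r.
apply/funext => x; rewrite /Q /= (opZ lZ) (opB lZ).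
apply: rdot_inj => w.
have := congr1 (fun z => rdot z w) (eZ x); rewrite rdotZl rdotDl /X rdotBl rdotZl.
rewrite !(rdotZl, rdotBl) => h.
have -> : c * (c * (rdot x w - rdot (Z x) w) - c * (rdot (Z x) w - rdot (Z (Z x)) w)) =
  c ^+ 2 * (rdot x w - 2 * rdot (Z x) w + rdot (Z (Z x)) w) by ring.
rewrite sqr_sqrtr ?(ltW M0) //.
have -> : rdot x w - 2 * rdot (Z x) w + rdot (Z (Z x)) w = M^-1 * rdot (W x) w by lra.
by rewrite mulrA mulfV ?mul1r // gt_eqF.
Qed.

Lemma sqrt_opP W : positive_op W -> positive_op (sqrt_op W) /\ sqrt_op W \o sqrt_op W = W.
Proof.
by move=> /sqrt_exists; apply: (@getPex _ [set Q | positive_op Q /\ Q \o Q = W]).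
Qed.

Lemma sqrt_op_eq Q : positive_op Q -> sqrt_op (Q \o Q) = Q.
Proof.
move=> pQ; have [p e] : positive_op (sqrt_op (Q \o Q)) /\
    sqrt_op (Q \o Q) \o sqrt_op (Q \o Q) = Q \o Q.
  by apply: (@getPex _ [set Q' | positive_op Q' /\ Q' \o Q' = Q \o Q]); exists Q.
exact: positive_sqrt_uniq e.
Qed.

Lemma abs_opP T : bounded_op T -> positive_op (abs_op T) /\
  abs_op T \o abs_op T = adjoint_op T \o T.
Proof. by move=> bT; apply/sqrt_opP/positive_comp_adj. Qed.

Lemma abs_op_norm T x : bounded_op T -> rnorm (abs_op T x) = rnorm (T x).
Proof.
move=> bT; have [pA eA] := abs_opP bT; apply/eqP.
rewrite -(@eqrXn2 _ 2) ?rnorm_ge0 // -!rdot_norm -positive_sa //.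
by rewrite -[abs_op T (abs_op T x)]/((abs_op T \o abs_op T) x) eA /= rdot_adjl.
Qed.

Lemma abs_op_pos Q : positive_op Q -> abs_op Q = Q.
Proof. by move=> pQ; rewrite /abs_op positive_adj // sqrt_op_eq. Qed.

End SquareRoot.

(** * Eigenvectors of positive operators *)

Section Spectral.
Context {R : realType} {H : hilbertType R}.
Implicit Types (S T U C Q : H -> H) (V E : set H) (x y z w g h : H) (r e l : R).

(** What compactness is needed for, stated for nested families of subsets of the
    unit ball: the images of the elements of the family have a cluster point.
    Compactness of [Q] gives it for all products [Y Q Z] at once, see
    [compact_clustering]. *)
Definition clustering_op C := forall G : R -> set H,
  (forall e, 0 < e -> G e !=set0) -> (forall e e', e <= e' -> G e `<=` G e') ->
  (forall e x, G e x -> rnorm x <= 1) ->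
  exists h, forall e, 0 < e -> exists2 x, G e x & rnorm (C x - h) <= e.

Lemma compact_clustering Q Y Z : compact_op Q -> bounded_op Y -> bounded_op Z ->
  clustering_op (Y \o Q \o Z).
Proof.
move=> [bQ [B QB [cB _]]] bY bZ G G0 Gmono G1.
have [M M0 hM] := bop_bound bZ; have [N N0 hN] := bop_bound bY.
(* Dividing by M brings Z x back to the unit ball. *)
pose q x := Q ((M^-1)%:C *: Z x).
pose F : set_system H := filter_from [set e : R | 0 < e] (fun e => q @` G e).
have FF : ProperFilter F.
  apply: filter_from_proper => [|e e0]; last first.
    by have [x Gx] := G0 e e0; exists (q x), x.
  apply: filter_from_filter; first by exists 1 => /=.
  move=> e e' /= e0 e0'; exists (Num.min e e') => /=; first by rewrite lt_min e0.
  by move=> _ [x Gx <-]; split; exists x => //; apply: Gmono Gx; rewrite ge_min lexx ?orbT.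
have FB : F B.
  exists 1 => //= _ [x Gx <-]; apply: QB; exists ((M^-1)%:C *: Z x) => //=.
  rewrite rnormE -[1]/((1 : R)%:C) lecR rnormZ ger0_norm ?invr_ge0 ?(ltW M0) //.
  by rewrite mulrC ler_pdivrMr // mul1r (le_trans (hM x)) // ler_piMr ?(ltW M0) // (G1 _ _ Gx).
have [h [_ hh]] := cB F FF FB.
exists (M%:C *: Y h) => e e0.
have d0 : 0 < e / (M * N) by rewrite divr_gt0 // mulr_gt0.
have [||_ [[x Gx <-] bx]] := hh (q @` G e) (ball h (e / (M * N))%:C).
- by exists e.
- by apply: nbhsx_ballx; rewrite ltcR.
exists x => //=; move: bx; rewrite -ball_normE /ball_ /= rnormE ltcR => /ltW bx.
have -> : Q (Z x) = M%:C *: q x.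
  by rewrite /q (opZ (bop_lin bQ)) scalerA -rmorphM /= mulfV ?scale1r // gt_eqF.
rewrite (opZ (bop_lin bY)) -scalerBr -(opB (bop_lin bY)) rnormZ gtr0_norm //.
rewrite (le_trans (ler_wpM2l (ltW M0) (hN _))) // rnormBC.
by rewrite mulrA mulrC -ler_pdivlMr // mulr_gt0.
Qed.

Definition eigenvectors S : set H := [set x | exists l : R, S x = l%:C *: x].

Lemma ortho_invariant S E x : positive_op S -> E `<=` eigenvectors S ->
  Defs.ortho E x -> Defs.ortho E (S x).
Proof.
move=> pS ES Vx y Ey; rewrite positive_innerC //; have [l ->] := ES _ Ey.
by rewrite innerZr Vx // mulr0.
Qed.

(** Since [S + l] is injective for [l > 0]. *)
Lemma positive_sq_eigen S x l : positive_op S -> 0 < l ->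
  S (S x) = (l ^+ 2)%:C *: x -> S x = l%:C *: x.
Proof.
move=> pS l0 SSx; have lS := bop_lin (positive_bop pS).
pose y := S x - l%:C *: x.
have Sy : S y = - (l%:C *: y).
  rewrite /y (opB lS) (opZ lS) SSx.
  by apply: rdot_inj => w; rewrite !(rdotBl, rdotZl, rdotNl); ring.
have := positive_ge0 y pS; rewrite Sy rdotNl rdotZl oppr_ge0 => h.
apply/eqP; rewrite -subr_eq0 -/y; apply/eqP/rdot_eq0/eqP.
by rewrite eq_le rdot_ge0 andbT -(pmulr_rle0 _ l0).
Qed.

(** The spectral theorem for compact operators, one eigenvector at a time. On the
    orthocomplement of a set of eigenvectors, which [S] leaves invariant, the
    norm [mu] of [S] is attained at an eigenvector: vectors that nearly attain
    it are approximate eigenvectors of [S^2], and their images cluster. *)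
Lemma eigen_exists S E g : positive_op S -> clustering_op (S \o S) ->
  E `<=` eigenvectors S -> Defs.ortho E g -> S g != 0 ->
  exists mu f, [/\ 0 < mu, Defs.ortho E f, rnorm f = 1, S f = mu%:C *: f &
    forall x, Defs.ortho E x -> rnorm (S x) <= mu * rnorm x].
Proof.
move=> pS cS ES Vg Sg; set V := Defs.ortho E.
have bS := positive_bop pS; have lS := bop_lin bS.
have [V0 VD VZ Vcl] := @hsubspace_ortho _ _ E; rewrite -/V in V0 VD VZ Vcl.
have [M M0 hM] := bop_bound bS.
pose N := [set rnorm (S x) | x in [set x | V x /\ rnorm x <= 1]].
have Nub : ubound N M.
  by move=> _ [x [_ x1] <-]; rewrite (le_trans (hM x)) // ler_piMr // ltW.
have hN : has_sup N.
  split; last by exists M.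
  by exists (rnorm (S 0)), 0 => //; split=> //; rewrite rnorm0.
pose mu := sup N.
have hmu x : V x -> rnorm (S x) <= mu * rnorm x.
  have [->|] := eqVneq x 0; first by rewrite op0 // rnorm0 mulr0.
  rewrite -rnorm_gt0 => nx Vx.
  have : rnorm (S ((rnorm x)^-1%:C *: x)) <= mu.
    apply: ub_le_sup; first by case: hN.
    exists ((rnorm x)^-1%:C *: x) => //; split; first exact: VZ.
    by rewrite rnormZ ger0_norm ?invr_ge0 // mulVf // gt_eqF.
  by rewrite opZ // rnormZ ger0_norm ?invr_ge0 // mulrC ler_pdivrMr.
have mu0 : 0 < mu.
  have : 0 < mu * rnorm g by rewrite (lt_le_trans _ (hmu _ Vg)) // rnorm_gt0.
  by move=> h; rewrite ltNge; apply: contraTN h => h; rewrite -leNgt mulr_le0_ge0.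
have VS x : V x -> V (S x) by exact: ortho_invariant.
pose D x := S (S x) - (mu ^+ 2)%:C *: x.
have bD : bounded_op D.
  by apply: (bop_sub (bop_comp bS bS)); apply: bop_scale; exact: bop_id.
have Dx x : V x -> rnorm x <= 1 ->
    rnorm (D x) ^+ 2 <= mu ^+ 2 * (mu ^+ 2 - rnorm (S x) ^+ 2).
  move=> Vx x1; rewrite /D rnorm_sqB rnormZ rdotZr positive_sa // rdot_norm.
  rewrite ger0_norm ?sqr_ge0 //.
  have h1 : rnorm (S (S x)) ^+ 2 <= mu ^+ 2 * rnorm (S x) ^+ 2.
    by rewrite -exprMn ler_sqr ?nnegrE ?mulr_ge0 ?rnorm_ge0 ?(ltW mu0) //; exact/hmu/VS.
  have h2 : (mu ^+ 2 * rnorm x) ^+ 2 <= (mu ^+ 2) ^+ 2.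
    by rewrite exprMn ler_piMr ?sqr_ge0 // expr_le1.
  by move: h1 h2; move: (rnorm (S _)) (rnorm (S _)) => *; lra.
(* Vectors that nearly attain the norm mu and are nearly eigenvectors of S^2. *)
pose G e := [set x | [/\ V x, rnorm x <= 1, rnorm (D x) <= e & mu - e <= rnorm (S x)]].
have [e e0|e e' ee' x [Vx x1 h1 h2]|e x []//|h hh] := cS G.
(* By Dx, |D x|^2 <= mu^2 (mu - |S x|) (mu + |S x|) <= 2 mu^3 e', as soon as
   |S x| is at least mu - e'. *)
- pose e' := Num.min e (e ^+ 2 / (2 * mu ^+ 3)).
  have m3 : 0 < 2 * mu ^+ 3 by rewrite mulr_gt0 // exprn_gt0.
  have e'0 : 0 < e' by rewrite lt_min e0 divr_gt0 // exprn_gt0.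
  have [_ [x [Vx x1] <-]] := sup_adherent e'0 hN; rewrite -/mu => hx.
  have e'e : e' <= e by rewrite ge_min lexx.
  exists x; split=> //; last by rewrite (le_trans _ (ltW hx)) // lerB.
  rewrite -ler_sqr ?nnegrE ?(ltW e0) //; apply: (le_trans (Dx _ Vx x1)).
  have e'2 : e' * (2 * mu ^+ 3) <= e ^+ 2 by rewrite -ler_pdivlMr // ge_min lexx orbT.
  apply: le_trans e'2.
  have Sm : rnorm (S x) <= mu.
    by rewrite (le_trans (hmu _ Vx)) // ler_piMr // ltW.
  have : mu ^+ 2 - rnorm (S x) ^+ 2 <= e' * (2 * mu).
    have -> : mu ^+ 2 - rnorm (S x) ^+ 2 = (mu - rnorm (S x)) * (mu + rnorm (S x)) by ring.
    apply: ler_pM; rewrite ?subr_ge0 ?addr_ge0 ?(ltW mu0) //; lra.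
  move=> h; rewrite (le_trans (ler_wpM2l (sqr_ge0 mu) h)) // le_eqVlt; apply/orP; left.
  by apply/eqP; ring.
- split=> //; first exact: le_trans ee'.
  by rewrite (le_trans _ h2) // lerB.
have /choice[u hu] n : exists x, G n.+1%:R^-1 x /\ rnorm (S (S x) - h) <= n.+1%:R^-1.
  by have [|x ? ?] := hh n.+1%:R^-1; [rewrite invr_gt0|exists x].
pose f := ((mu ^+ 2)^-1)%:C *: h.
have m2 : 0 < mu ^+ 2 by rewrite exprn_gt0.
have uf : tends u f.
  move=> e e0; have [K hK] := invS_small (mulr_gt0 e0 (divr_gt0 m2 (ltr0n R 2))).
  exists K => n /hK Kn; have [[Vx x1 h1 _] h2] := hu n.
  have -> : u n - f = ((mu ^+ 2)^-1)%:C *: ((S (S (u n)) - h) - D (u n)).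
    rewrite /f /D; apply: rdot_inj => w.
    by rewrite !(rdotDl, rdotNl, rdotZl); field; rewrite gt_eqF.
  rewrite rnormZ ger0_norm ?invr_ge0 ?(ltW m2) // mulrC ler_pdivrMr //.
  rewrite (le_trans (rnormB _ _)) // (le_trans (lerD h2 h1)) //.
  by rewrite (le_trans (lerD Kn Kn)) // -mulrDr -splitr.
have Vf : V f by apply: Vcl uf => n; case: (hu n) => [[]].
have Df : D f = 0.
  apply: (tends_uniq (tends_op bD uf)) => e /invS_small[K hK]; exists K => n /hK Kn /=.
  by rewrite subr0 (le_trans _ Kn) //; case: (hu n) => [[]].
have Sf : mu <= rnorm (S f).
  apply/ler_addgt0Pr => e e0.
  have [K hK] := invS_small (divr_gt0 e0 (ltr0n R 2)).
  have [K' hK'] := tends_op bS uf (divr_gt0 e0 (ltr0n R 2)).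
  pose n := maxn K K'; have := hK n (leq_maxl _ _); have /= := hK' n (leq_maxr _ _).
  move=> h1 h2; have [[_ _ _ h3] _] := hu n.
  have : rnorm (S (u n)) <= rnorm (S f) + rnorm (S (u n) - S f).
    by rewrite (le_trans _ (rnormD _ _)) // addrC subrK.
  by move: h1 h2 h3; move: (n.+1%:R^-1) (mu) (rnorm _) (rnorm _) (rnorm _) => *; lra.
have nf : 0 < rnorm f.
  rewrite rnorm_gt0; apply: contraTneq Sf => ->.
  by rewrite op0 // rnorm0 -ltNge.
have Smf : S f = mu%:C *: f.
  apply: positive_sq_eigen => //; move/eqP: Df; rewrite /D subr_eq0.
  by move/eqP.
exists mu, ((rnorm f)^-1%:C *: f); split=> //.
- exact: VZ.
- by rewrite rnormZ ger0_norm ?invr_ge0 // mulVf // gt_eqF.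
- by rewrite (opZ lS _ f) Smf !scalerA [_%:C * mu%:C]mulrC.
Qed.

(** The kernel of [S] consists of eigenvectors, so a nonzero vector orthogonal to
    all of them would give a new one by [eigen_exists]. *)
Lemma ortho_eigenvectors S g : positive_op S -> clustering_op (S \o S) ->
  Defs.ortho (eigenvectors S) g -> g = 0.
Proof.
move=> pS cS og; have [Sg|Sg] := eqVneq (S g) 0.
  have : inner g g = 0 by apply: og; exists 0; rewrite Sg scale0r.
  by move/inner_rdot0 => [/rdot_eq0].
have [mu [f [_ of1 f1 Sf _]]] := eigen_exists pS cS (@subset_refl _ _) og Sg.
have : inner f f = 0 by apply: of1; exists mu.
move/inner_rdot0 => [/rdot_eq0 f0]; move: f1; rewrite f0 rnorm0 => /eqP.
by rewrite eq_sym oner_eq0.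
Qed.

End Spectral.

(** * Orthonormal sequences *)

Section Orthonormal.
Context {R : realType} {H : hilbertType R}.
Implicit Types (S T U : H -> H) (x y z w g h e f : H) (s t : seq H) (r l p : R).

Lemma inner_unit x : rnorm x = 1 -> inner x x = 1.
Proof. by move=> x1; rewrite inner_norm rnormE x1 expr1n. Qed.

Lemma inner_eq0C x y : inner x y = 0 -> inner y x = 0.
Proof.
move=> /inner_rdot0[a b]; apply/inner_rdot0.
by split; rewrite rdotC ?rdot_i ?b ?oppr0.
Qed.

Lemma orthonormal_consP x s : orthonormal inner (x :: s) <->
  [/\ rnorm x = 1, forall y, y \in s -> inner x y = 0 & orthonormal inner s].
Proof.
rewrite /orthonormal /= andbT; split.
  move=> /andP[/andP[/eqP x1 s1] /andP[/allP xs so]]; split.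
  - have := rdot_norm x; rewrite /rdot x1 /= => /esym/eqP.
    by rewrite sqrf_eq1 => /orP[/eqP //|/eqP xN]; have := rnorm_ge0 x; rewrite xN; lra.
  - by move=> y /xs /eqP.
  - by rewrite s1.
move=> [x1 xs /andP[s1 so]]; rewrite inner_unit // eqxx s1 so /= andbT.
by apply/allP => y /xs /= ->.
Qed.

Lemma orthonormal_rconsP x s : orthonormal inner (s ++ [:: x]) <->
  [/\ rnorm x = 1, forall y, y \in s -> inner x y = 0 & orthonormal inner s].
Proof.
elim: s => [|y s IH] /=.
  by split=> [/orthonormal_consP[x1 _ _]|[x1 _ _]] //; apply/orthonormal_consP.
split=> [/orthonormal_consP[y1 ys /IH[x1 xs so]]|[x1 xs /orthonormal_consP[y1 ys so]]].
  split=> // [z|]; last first.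
    by apply/orthonormal_consP; split=> // z zs; apply: ys; rewrite mem_cat zs.
  rewrite inE => /orP[/eqP ->|/xs //].
  by apply: inner_eq0C; apply: ys; rewrite mem_cat mem_head orbT.
apply/orthonormal_consP; split=> //.
  move=> z; rewrite mem_cat inE => /orP[/ys //|/eqP ->].
  by apply: inner_eq0C; apply: xs; rewrite mem_head.
by apply/IH; split=> // z zs; apply: xs; rewrite inE zs orbT.
Qed.

Lemma orthonormal_unit s x : orthonormal inner s -> x \in s -> rnorm x = 1.
Proof.
elim: s => // y s IH /orthonormal_consP[y1 _ so]; rewrite inE => /orP[/eqP -> //|].
exact: IH.
Qed.

Lemma orthonormal_filter s (P : pred H) :
  orthonormal inner s -> orthonormal inner [seq x <- s | P x].
Proof.
move=> so; have /orthonormalP[us _] := so; apply: sub_orthonormal so.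
  by move=> x; rewrite mem_filter => /andP[].
exact: filter_uniq.
Qed.

(** The squared modulus of [inner x e]. *)
Definition weight x e : R := rdot x e ^+ 2 + rdot x ('i *: e) ^+ 2.

Lemma weight_ge0 x e : 0 <= weight x e.
Proof. by rewrite addr_ge0 ?sqr_ge0. Qed.

Lemma weightC x e : weight x e = weight e x.
Proof. by rewrite /weight (rdotC e x) (rdotC e) rdot_i sqrrN. Qed.

Lemma weight_inner x e z : inner x e = inner z e -> weight x e = weight z e.
Proof. by rewrite !innerE /weight => -[-> ->]. Qed.

(** For an orthonormal sequence [s] this is the component of [x] orthogonal to [s].
    Subtracting the components one after the other makes every identity below a
    step-by-step induction. *)
Fixpoint residual s x : H :=
  if s is e :: s' then residual s' (x - inner x e *: e) else x.

Lemma residual_ortho s x e : orthonormal inner s ->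
  (e \in s) || (inner x e == 0) && all (fun f => inner f e == 0) s ->
  inner (residual s x) e = 0.
Proof.
elim: s x e => [|f s IH] x e /=; first by move=> _ /andP[/eqP].
move=> /orthonormal_consP[f1 fs so]; rewrite inE -orbA => /or3P[/eqP ->|es|].
- apply: IH => //; apply/orP; right.
  rewrite innerDl innerNl innerZl inner_unit // mulr1 subrr eqxx /=.
  by apply/allP => y /fs /inner_eq0C /= ->.
- by apply: IH => //; rewrite es.
- case/and3P => /eqP xe /eqP fe sf; apply: IH => //; apply/orP; right.
  by rewrite innerDl innerNl innerZl xe fe mulr0 subrr eqxx.
Qed.

Lemma residualP s x e : orthonormal inner s -> e \in s -> inner (residual s x) e = 0.
Proof. by move=> so es; apply: residual_ortho => //; rewrite es. Qed.

Lemma quad_step S x e : positive_op S -> rnorm e = 1 -> eigenvectors S e ->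
  rdot (S x) x = weight x e * rdot (S e) e +
    rdot (S (x - inner x e *: e)) (x - inner x e *: e).
Proof.
move=> pS e1 [l Se]; have lS := bop_lin (positive_bop pS).
pose a := rdot x e; pose b := rdot x ('i *: e).
have -> : inner x e *: e = a%:C *: e + b%:C *: ('i *: e).
  rewrite scalerA -scalerDl; congr (_ *: _); rewrite innerE -/a -/b.
  by apply/eqP; rewrite eq_complex /= !mul0r !mulr0 !mulr1 !subr0 !addr0 !add0r !eqxx.
rewrite (opB lS) (opD lS) !(opZ lS) Se.
have e2 : rdot e e = 1 by rewrite rdot_norm e1 expr1n.
have ei : rdot e ('i *: e) = 0.
  by have := rdot_i e e; rewrite rdotC; lra.
have ie : rdot ('i *: e) e = 0 by rewrite rdotC.
have ii : rdot ('i *: e) ('i *: e) = 1 by rewrite rdot_i scale_iK rdotNr opprK.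
have sx : rdot (S x) e = l * a by rewrite positive_sa // Se rdotZr.
have ix : rdot (S x) ('i *: e) = l * b.
  by rewrite positive_sa // (opZ lS) Se scalerA mulrC -scalerA rdotZr.
have -> : 'i%C *: (l%:C *: e) = l%:C *: ('i%C *: e) by rewrite !scalerA mulrC.
rewrite !(rdotDl, rdotDr, rdotNl, rdotNr, rdotZl, rdotZr) sx ix (rdotC e x) -/a.
rewrite (rdotC ('i *: e) x) -/b e2 ei ie ii /weight -/a -/b; ring.
Qed.

(** The quadratic form of [S] has no cross terms between an eigenvector and its
    orthocomplement. For [S = id] this is Pythagoras. *)
Lemma quad_expand S s x : positive_op S -> orthonormal inner s ->
  (forall e, e \in s -> eigenvectors S e) ->
  rdot (S x) x = \sum_(e <- s) weight x e * rdot (S e) e +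
     rdot (S (residual s x)) (residual s x).
Proof.
move=> pS; elim: s x => [|e s IH] x; first by rewrite big_nil add0r.
move=> /orthonormal_consP[e1 es so] hs; rewrite big_cons /=.
rewrite {1}(quad_step x pS e1 (hs _ (mem_head _ _))) (IH (x - inner x e *: e)) //; last first.
  by move=> f fs; apply: hs; rewrite inE fs orbT.
rewrite addrA; congr (_ + _ + _); rewrite !big_seq; apply: eq_bigr => f fs.
congr (_ * _); apply: weight_inner.
by rewrite innerDl innerNl innerZl es // mulr0 subr0.
Qed.

Lemma positive_id : positive_op (@id H).
Proof. by apply: positiveI => [|//|x /=]; [exact: bop_id|exact: rdot_ge0]. Qed.

Lemma norm_expand s x : orthonormal inner s ->
  rnorm x ^+ 2 = \sum_(e <- s) weight x e + rnorm (residual s x) ^+ 2.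
Proof.
move=> so; rewrite -!rdot_norm.
rewrite (@quad_expand _ s x positive_id so); last first.
  by move=> e _; exists 1; rewrite scale1r.
congr (_ + _); rewrite !big_seq; apply: eq_bigr => e es.
by rewrite rdot_norm (orthonormal_unit so es) expr1n mulr1.
Qed.

Lemma bessel s x : orthonormal inner s -> \sum_(e <- s) weight x e <= rnorm x ^+ 2.
Proof. by move=> so; rewrite (norm_expand x so) lerDl sqr_ge0. Qed.

(** There are more unknown coefficients than linear conditions on them. *)
Lemma indep_ortho (n : nat) (e : 'I_n -> H) t : lin_indep e -> (size t < n)%N ->
  exists c : 'I_n -> R[i], let x := \sum_i c i *: e i in
    x != 0 /\ forall y, y \in t -> inner x y = 0.
Proof.
move=> ie tn; pose A : 'M[R[i]]_(n, size t) :=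
  \matrix_(i, j) inner (e i) (tnth (in_tuple t) j).
have : kermx A != 0.
  rewrite -mxrank_eq0 mxrank_ker subn_eq0 -ltnNge.
  exact: leq_ltn_trans (rank_leq_col A) tn.
move=> /rowV0Pn[u]; rewrite sub_kermx => /eqP uA u0.
exists (u 0) => /=; split.
  apply: contraNneq u0 => /ie c0; apply/eqP/rowP => i.
  by rewrite mxE c0.
move=> y /(tnthP (in_tuple t))[j ->].
have := congr1 (fun M : 'rV_(size t) => M 0 j) uA; rewrite !mxE => <-.
rewrite (big_morph (fun z => inner z _) (fun a b => innerDl a b _) (linear0l _ _)).
apply: eq_bigr => i _.
by rewrite mxE innerZl.
Qed.

End Orthonormal.

(** * Power sums of quadratic forms *)

Section PowerSums.
Context {R : realType} {H : hilbertType R}.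
Implicit Types (S T U : H -> H) (x y z w g h e f : H) (s t : seq H) (r l p : R).

(** For a unit eigenvector [e] this is its eigenvalue. *)
Definition quad S e : R := rdot (S e) e.

Definition powsum p S s : R := \sum_(e <- s) quad S e `^ p.

Definition eigenfamily S s :=
  orthonormal inner s /\ forall e, e \in s -> eigenvectors S e.

Lemma quad_eigenvector S e : rnorm e = 1 -> eigenvectors S e ->
  S e = (quad S e)%:C *: e.
Proof.
by move=> e1 [l Se]; rewrite /quad {2}Se rdotZl rdot_norm e1 expr1n mulr1.
Qed.

Lemma powsum_mono p S T s : 0 <= p -> positive_op S -> 
  (forall e, e \in s -> quad S e <= quad T e) -> powsum p S s <= powsum p T s.
Proof.
move=> p0 pS ST; rewrite /powsum !big_seq; apply: ler_sum => e es.
have qS := positive_ge0 e pS.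
by apply: ge0_ler_powR; rewrite ?nnegrE // ?ST // (le_trans qS) // ST.
Qed.

(** An eigenfamily of maximal size among those with eigenvalues at least [eps]: the
    bound on the power sums makes their sizes bounded, and by maximality what
    remains of [S] on the orthocomplement has norm at most [eps]. *)
Lemma finite_stage S p (sigma eps : R) : positive_op S -> clustering_op (S \o S) ->
  0 < p -> 0 < eps -> (forall s, eigenfamily S s -> powsum p S s <= sigma) ->
  exists2 s, eigenfamily S s &
    forall x, (forall e, e \in s -> inner x e = 0) -> rnorm (S x) <= eps * rnorm x.
Proof.
move=> pS cS p0 eps0 hs.
pose P n := `[< exists s, [/\ eigenfamily S s,
  forall e, e \in s -> eps <= quad S e & size s = n] >].
have exP : exists n, P n.
  by exists 0%N; apply/asboolP; exists [::]; split=> //; split.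
have ubP n : P n -> (n <= Num.truncn (sigma / eps `^ p))%N.
  move=> /asboolP[s [es se <-]].
  have ep0 : 0 < eps `^ p by rewrite powR_gt0.
  have h : (size s)%:R * eps `^ p <= sigma.
    rewrite (le_trans _ (hs _ es)) // -(count_predT s); apply: count_le_sum => [e|e ? _].
      exact: powR_ge0.
    by apply: ge0_ler_powR; rewrite ?nnegrE ?(ltW p0) ?(ltW eps0) ?positive_ge0 // se.
  have s0 : 0 <= sigma by rewrite (le_trans _ h) // mulr_ge0 // powR_ge0.
  by rewrite truncn_ge_nat ?divr_ge0 ?powR_ge0 // ler_pdivlMr.
case: (ex_maxnP exP ubP) => n /asboolP[s [es se sn]] nmax.
exists s => // x xs; rewrite leNgt; apply/negP => Sx.
have Sx0 : S x != 0.
  rewrite -rnorm_gt0 (le_lt_trans _ Sx) // mulr_ge0 ?(ltW eps0) ?rnorm_ge0 //.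
have [||mu [f [mu0 of1 f1 Sf Smu]]] := @eigen_exists _ _ S [set` s] x pS cS _ _ Sx0.
- by move=> e /= ?; apply: es.2.
- by move=> e /= ?; exact: xs.
have mueps : eps < mu.
  have := lt_le_trans Sx (Smu x xs); have [->|] := eqVneq (rnorm x) 0.
    by rewrite !mulr0 ltxx.
  by move=> x0; rewrite ltr_pM2r // lt_neqAle eq_sym x0 rnorm_ge0.
have : (n.+1 <= n)%N; last by rewrite ltnn.
apply: nmax; apply/asboolP; exists (f :: s); split=> /=; last by rewrite sn.
- split; first by apply/orthonormal_consP; split=> //; case: es.
  by move=> e; rewrite inE => /orP[/eqP ->|/es.2 //]; exists mu.
- move=> e; rewrite inE => /orP[/eqP ->|/se //].
  by rewrite /quad Sf rdotZl rdot_norm f1 expr1n mulr1 ltW.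
Qed.

(** By the spectral decomposition, the number [quad S f] is, up to [eps], an average
    of eigenvalues with weights [weight f e]; by Jensen its power is at most the
    average of the powers. Summing over [f] first, the weights of each [e] add up
    to at most one by Bessel. *)
Lemma powsum_le_eigen S p (sigma : R) : positive_op S -> clustering_op (S \o S) ->
  1 <= p -> (forall s, eigenfamily S s -> powsum p S s <= sigma) ->
  forall t, orthonormal inner t -> powsum p S t <= sigma.
Proof.
move=> pS cS p1 hs t ot; have p0 : 0 < p by apply: lt_le_trans p1.
rewrite -subr_le0; apply: (@small_le0 _ _ (size t).+1%:R) => // eps eps0 eps1.
have [s es hres] := finite_stage pS cS p0 eps0 hs.
have os : orthonormal inner s by case: es.
have epsp : eps `^ p <= eps by apply: ge1r_powR => //; rewrite eps0.
have one f : f \in t ->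
    quad S f `^ p <= \sum_(e <- s) weight f e * quad S e `^ p + eps.
  move=> ft; pose r := residual s f.
  have f1 := orthonormal_unit ot ft.
  have tot := norm_expand f os; rewrite f1 expr1n -/r in tot.
  have r1 : rnorm r ^+ 2 <= 1.
    by rewrite tot lerDr sumr_ge0 // => e _; exact: weight_ge0.
  (* The residual of f counts as one more point, None, with value eps. *)
  pose w (o : option H) := if o is Some e then weight f e else rnorm r ^+ 2.
  pose a (o : option H) := if o is Some e then quad S e else eps.
  have := @jensen_powR _ _ (None :: map Some s) w a p p1.
  rewrite !big_cons !big_map /= => /(_ _ _ _)/le_trans j.
  have {j} : (rnorm r ^+ 2 * eps + \sum_(e <- s) weight f e * quad S e) `^ p <=
      rnorm r ^+ 2 * eps `^ p + \sum_(e <- s) weight f e * quad S e `^ p.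
    apply: j => //; first by case=> [e|]; [exact: weight_ge0|exact: sqr_ge0].
      by case=> [e|]; [exact: positive_ge0|exact: ltW].
    by rewrite addrC -tot.
  have : quad S f <= rnorm r ^+ 2 * eps + \sum_(e <- s) weight f e * quad S e.
    rewrite {1}/quad (quad_expand f pS os es.2) addrC lerD2r -/r.
    have Sr : rnorm (S r) <= eps * rnorm r by apply: hres => e se; exact: residualP.
    by rewrite (le_trans (rdot_le _ _)) // (le_trans (ler_wpM2r _ Sr)) // -mulrA -expr2 mulrC.
  move=> h1 h2; apply: (@le_trans _ _ ((rnorm r ^+ 2 * eps +
      \sum_(e <- s) weight f e * quad S e) `^ p)).
    apply: ge0_ler_powR; rewrite ?nnegrE ?(ltW p0) ?positive_ge0 //.
    exact: le_trans (positive_ge0 f pS) h1.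
  rewrite (le_trans h2) // addrC lerD2l (le_trans _ epsp) //.
  by rewrite ler_piMl // powR_ge0.
rewrite lerBlDl (@le_trans _ _ (\sum_(f <- t)
  (\sum_(e <- s) weight f e * quad S e `^ p + eps))) //.
  by rewrite /powsum !big_seq; apply: ler_sum => f ft; exact: one.
rewrite big_split /= lerD //.
  rewrite exchange_big /= (le_trans _ (hs _ es)) // /powsum !big_seq; apply: ler_sum => e se.
  rewrite -mulr_suml ler_piMl ?powR_ge0 //.
  under eq_bigr do rewrite weightC.
  by rewrite (le_trans (bessel e ot)) // (orthonormal_unit os se) expr1n.
rewrite (@le_trans _ _ ((size t)%:R * eps)) //; last first.
  by rewrite ler_wpM2r ?(ltW eps0) // ler_nat.
elim: (t) => [|f t' IH]; first by rewrite big_nil mul0r.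
by rewrite big_cons /= -natr1 mulrDl mul1r addrC lerD2r.
Qed.

End PowerSums.

(** * Sums over eigenvalues *)

Section SchattenSum.
Context {R : realType} {H : hilbertType R}.
Implicit Types (S T U : H -> H) (x y z w g h e f : H) (s t : seq H) (r l p : R).

Lemma orthonormal_indep s : orthonormal inner s ->
  lin_indep (fun i : 'I_(size s) => tnth (in_tuple s) i).
Proof.
move=> /orthonormalP[us os] c c0 j.
have := congr1 (fun z => inner z (tnth (in_tuple s) j)) c0.
rewrite (big_morph (fun z => inner z _) (fun a b => innerDl a b _) (linear0l _ _)).
rewrite linear0l (bigD1 j) //= innerZl os ?mem_tnth // eqxx mulr1.
rewrite big1 ?addr0 // => i ij; rewrite innerZl os ?mem_tnth //.
rewrite !(tnth_nth 0) nth_uniq //= val_eqE (negbTE ij) mulr0 //.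
Qed.

Lemma orthonormal_dim s (V : set H) : orthonormal inner s -> (forall e, e \in s -> V e) ->
  ((size s)%:R%:E <= subspace_dim V)%E.
Proof.
move=> os sV; apply: ereal_sup_ubound; exists (size s) => //=.
exists (fun i => tnth (in_tuple s) i); split; last exact: orthonormal_indep.
by move=> i; apply: sV; rewrite mem_tnth.
Qed.

(** In an eigenspace of dimension at least [n], fewer than [n] vectors leave room for
    an orthogonal one; the members of the family with another eigenvalue are
    orthogonal to it anyway. *)
Lemma extend_one S s l n : positive_op S -> eigenfamily S s ->
  (exists e : 'I_n -> H, (forall i, eigenspace_op S l (e i)) /\ lin_indep e) ->
  (count (fun e => quad S e == l) s < n)%N ->
  exists2 x, eigenfamily S (s ++ [:: x]) & quad S x = l.
Proof.
move=> pS [os es] [e [eV ie]] sn; have lS := bop_lin (positive_bop pS).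
pose t := [seq e <- s | quad S e == l].
have [|c [c0 ct]] := @indep_ortho _ _ _ e t ie; first by rewrite size_filter.
set z := \sum_i _ in c0 ct.
have Sz : S z = l%:C *: z.
  rewrite /z (big_morph S (opD lS) (op0 lS)) scaler_sumr; apply: eq_bigr => i _.
  by rewrite (opZ lS) eV !scalerA mulrC.
have nz : 0 < rnorm z by rewrite rnorm_gt0.
pose x := (rnorm z)^-1%:C *: z.
have x1 : rnorm x = 1 by rewrite rnormZ ger0_norm ?invr_ge0 // mulVf // gt_eqF.
have Sx : S x = l%:C *: x by rewrite /x (opZ lS) Sz !scalerA mulrC.
exists x; last by rewrite /quad Sx rdotZl rdot_norm x1 expr1n mulr1.
split; last first.
  move=> y; rewrite mem_cat inE => /orP[/es //|/eqP ->]; by exists l.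
apply/orthonormal_rconsP; split=> // y ys.
have [yl|yl] := eqVneq (quad S y) l.
  by rewrite /x innerZl ct ?mulr0 // mem_filter yl eqxx.
have Sy := quad_eigenvector (orthonormal_unit os ys) (es _ ys).
have := positive_innerC x y pS; rewrite Sx Sy innerZl innerZr conjc_real => /eqP.
rewrite -subr_eq0 -mulrBl mulf_eq0 -rmorphB /= => /orP[|/eqP //].
by rewrite eq_complex /= eqxx andbT subr_eq0 eq_sym (negbTE yl).
Qed.

Lemma extend_family S s l n : positive_op S -> eigenfamily S s ->
  (exists e : 'I_n -> H, (forall i, eigenspace_op S l (e i)) /\ lin_indep e) ->
  exists2 t, eigenfamily S (s ++ t) & (n <= count (fun e => quad S e == l) (s ++ t))%N.
Proof.
move=> pS es ie; pose cnt := count (fun e => quad S e == l).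
suff h k : (k <= n)%N -> exists2 t, eigenfamily S (s ++ t) & (k <= cnt (s ++ t))%N by exact: h.
elim: k => [_|k IH kn]; first by exists [::]; rewrite ?cats0.
have [t et kt] := IH (ltnW kn).
have [kt'|kt'] := ltnP k (cnt (s ++ t)); first by exists t.
have [x ex qx] := extend_one pS et ie (leq_ltn_trans kt' kn).
exists (t ++ [:: x]); first by rewrite catA.
by rewrite /cnt catA count_cat /= qx eqxx addn1 ltnS.
Qed.

Lemma extend_families S s (ls : seq R) (d : R -> nat) : positive_op S -> eigenfamily S s ->
  (forall l, l \in ls -> exists e : 'I_(d l) -> H,
     (forall i, eigenspace_op S l (e i)) /\ lin_indep e) ->
  exists2 t, eigenfamily S (s ++ t) &
    forall l, l \in ls -> (d l <= count (fun e => quad S e == l) (s ++ t))%N.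
Proof.
move=> pS es; elim: ls => [|l ls IH] h; first by exists [::]; rewrite ?cats0.
have [|t et ht] := IH; first by move=> k kls; apply: h; rewrite inE kls orbT.
have [t' et' ht'] := extend_family pS et (h l (mem_head _ _)).
exists (t ++ t'); first by rewrite catA.
move=> k; rewrite inE catA => /orP[/eqP -> //|/ht kt].
by rewrite (leq_trans kt) // [in leqRHS]count_cat leq_addr.
Qed.

(** [schatten_sum p T] is [eigensum p (abs_op T)] by definition. *)
Definition eigensum p S : \bar R :=
  (\esum_(l in [set l : R | (0 < l)%R]) subspace_dim (eigenspace_op S l) * (l `^ p)%:E)%E.

Lemma powsum_le_eigensum S p s : 0 < p -> positive_op S -> eigenfamily S s ->
  ((powsum p S s)%:E <= eigensum p S)%E.
Proof.
move=> p0 pS [os es].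
pose u := undup [seq quad S e | e <- s & 0 < quad S e].
apply: esum_ge; exists [set` u].
  split; first exact: finite_seq.
  by move=> l /=; rewrite mem_undup => /mapP[e]; rewrite mem_filter => /andP[? _] ->.
rewrite -fsbig_seq ?undup_uniq //.
have -> : powsum p S s = \sum_(l <- u) (count (fun e => quad S e == l) s)%:R * l `^ p.
  rewrite sum_count ?undup_uniq // /powsum [RHS]big_mkcond !big_seq.
  apply: eq_bigr => e se; case: ifPn => //; rewrite mem_undup => qu.
  have : quad S e <= 0.
    rewrite leNgt; apply: contra qu => qe; apply/mapP; exists e => //.
    by rewrite mem_filter qe.
  move=> q0; have -> : quad S e = 0 by apply/eqP; rewrite eq_le q0 positive_ge0.
  by rewrite powR0 // gt_eqF.
rewrite -sumEFin; apply: lee_sum => l _; rewrite EFinM lee_wpmul2r ?lee_fin ?powR_ge0 //.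
rewrite -size_filter; apply: orthonormal_dim; first exact: orthonormal_filter.
move=> e; rewrite mem_filter => /andP[/eqP <- se].
by apply: quad_eigenvector; [exact: orthonormal_unit se|exact: es].
Qed.

(** The sum over eigenvalues is a supremum of power sums over eigenfamilies, and
    the families can be required to start with any given eigenfamily [s], since
    every eigenfamily extends to one that exhausts prescribed multiplicities. The
    case [s = [:: f]] is what makes the comparison of sums strict. *)
Lemma eigensum_le S p s (sigma : R) : positive_op S -> eigenfamily S s ->
  (forall t, eigenfamily S (s ++ t) -> powsum p S (s ++ t) <= sigma) ->
  (eigensum p S <= sigma%:E)%E.
Proof.
move=> pS es hs.
have quad_count t l : (count (fun e => quad S e == l) t)%:R * l `^ p <= powsum p S t.
  by apply: count_le_sum => [e|e _ /eqP ->//]; exact: powR_ge0.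
have /choice[d hd] l : exists n, 0 < l ->
    subspace_dim (eigenspace_op S l) = n%:R%:E /\
    exists e : 'I_n -> H, (forall i, eigenspace_op S l (e i)) /\ lin_indep e.
  case: (ltrP 0 l) => l0; last by exists 0%N.
  have lp : 0 < l `^ p by rewrite powR_gt0.
  pose P n := `[< exists e : 'I_n -> H, (forall i, eigenspace_op S l (e i)) /\ lin_indep e >].
  have exP : exists n, P n.
    by exists 0%N; apply/asboolP; exists (fun=> 0); split=> [[]|c _ []].
  have ubP n : P n -> (n <= Num.truncn (sigma / l `^ p))%N.
    move=> /asboolP /(extend_family pS es)[t et nt].
    have h : n%:R * l `^ p <= sigma.
      rewrite (le_trans _ (hs _ et)) // (le_trans _ (quad_count _ l)) //.
      by rewrite ler_wpM2r ?powR_ge0 // ler_nat.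
    rewrite truncn_ge_nat ?ler_pdivlMr // mul0r.
    by rewrite (le_trans _ h) // mulr_ge0 // powR_ge0.
  case: (ex_maxnP exP ubP) => n /asboolP en nmax; exists n => _; split=> //.
  apply/eqP; rewrite eq_le; apply/andP; split.
    by apply: ge_ereal_sup => _ [m em <-]; rewrite lee_fin ler_nat; apply/nmax/asboolP.
  by apply: ereal_sup_ubound; exists n.
apply: ge_ereal_sup => _ [X [/finite_seqP[u0 ->] Xpos] <-].
pose u := undup u0; have -> : [set` u0] = [set` u].
  by apply/seteqP; split=> x /=; rewrite mem_undup.
have upos l : l \in u -> 0 < l by rewrite mem_undup => /Xpos.
rewrite -fsbig_seq ?undup_uniq //.
have [t et ht] : exists2 t, eigenfamily S (s ++ t) &
    forall l, l \in u -> (d l <= count (fun e => quad S e == l) (s ++ t))%N.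
  by apply: extend_families => // l /upos l0; case: (hd l l0).
rewrite (@le_trans _ _ (\sum_(l <- u) (d l)%:R * l `^ p)%:E) //.
  rewrite -sumEFin !big_seq; apply: lee_sum => l /upos l0.
  by have [-> _] := hd l l0.
rewrite lee_fin (le_trans _ (hs _ et)) //.
rewrite (@le_trans _ _ (\sum_(l <- u)
  (count (fun e => quad S e == l) (s ++ t))%:R * l `^ p)) //.
  rewrite !big_seq; apply: ler_sum => l lu.
  by rewrite ler_wpM2r ?powR_ge0 // ler_nat ht.
rewrite sum_count ?undup_uniq // big_mkcond; apply: ler_sum => e _.
by case: ifP => // _; rewrite powR_ge0.
Qed.

End SchattenSum.

(** * Comparison of Schatten sums *)

Section Comparison.
Context {R : realType} {H : hilbertType R}.
Implicit Types (S T U Q Y Z : H -> H) (x y z w g h e f : H) (s t : seq H) (r l p : R).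

Lemma abs_op_norm_eq S T : bounded_op S -> bounded_op T ->
  (forall x, rnorm (S x) = rnorm (T x)) -> abs_op S = abs_op T.
Proof.
move=> bS bT ST; apply: positive_norm_uniq => [||x].
- by case: (abs_opP bS).
- by case: (abs_opP bT).
- by rewrite !abs_op_norm.
Qed.

Lemma abs_op_le S T : bounded_op S -> bounded_op T ->
  (forall x, rnorm (S x) <= rnorm (T x)) ->
  forall e, quad (abs_op S) e <= quad (abs_op T) e.
Proof.
move=> bS bT ST e; have [pS _] := abs_opP bS; have [pT _] := abs_opP bT.
by apply: sqrt_monotone => // x; rewrite !abs_op_norm.
Qed.

Lemma eigensum_ge0 p S : (0 <= eigensum p S)%E.
Proof.
apply: esum_ge0 => l _; apply: mule_ge0; last by rewrite lee_fin powR_ge0.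
apply: ereal_sup_ubound; exists 0%N => //; exists (fun=> 0).
by split=> [[]|c _ []].
Qed.

(** The hypothesis under which the modulus of [T] has a spectral decomposition,
    since [adjoint_op T \o T] is its square. *)
Definition modulus_clustering T := clustering_op (adjoint_op T \o T).

Lemma modulus_clusteringE T : bounded_op T -> modulus_clustering T ->
  clustering_op (abs_op T \o abs_op T).
Proof. by move=> bT; have [_ ->] := abs_opP bT. Qed.

Lemma powsum_le_schatten p T s : 1 <= p -> bounded_op T -> modulus_clustering T ->
  orthonormal inner s -> ((powsum p (abs_op T) s)%:E <= schatten_sum p T)%E.
Proof.
move=> p1 bT cT os; have [pT _] := abs_opP bT.
have p0 : 0 < p by apply: lt_le_trans p1.
rewrite -[schatten_sum p T]/(eigensum p (abs_op T)).
have := eigensum_ge0 p (abs_op T).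
case E : (eigensum p (abs_op T)) => [sg| |] // _; last by rewrite leey.
rewrite lee_fin; apply: powsum_le_eigen => //; first exact: modulus_clusteringE.
by move=> t et; rewrite -lee_fin -E; exact: powsum_le_eigensum.
Qed.

Lemma schatten_sum_mono p S T : 1 <= p -> bounded_op S -> bounded_op T ->
  modulus_clustering T -> (forall x, rnorm (S x) <= rnorm (T x)) ->
  (schatten_sum p S <= schatten_sum p T)%E.
Proof.
move=> p1 bS bT cT ST; have [pS _] := abs_opP bS.
have p0 : 0 <= p by apply: le_trans p1.
have := eigensum_ge0 p (abs_op T); rewrite -[eigensum _ _]/(schatten_sum p T).
case E : (schatten_sum p T) => [sg| |] // _; last by rewrite leey.
apply: (@eigensum_le _ _ _ _ [::]) => [//||t [os _]]; first by split.
rewrite -lee_fin -E; apply: le_trans (powsum_le_schatten p1 bT cT os).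
by rewrite lee_fin; apply: powsum_mono => // e _; exact: abs_op_le.
Qed.

(** If the moduli differ, then they differ on an eigenvector [e] of the smaller one.
    For every orthonormal sequence starting with [e], the two power sums then
    differ by at least the fixed gap [c] between their first terms. *)
Lemma schatten_sum_strict p S T : 1 <= p -> bounded_op S -> bounded_op T ->
  modulus_clustering S -> modulus_clustering T ->
  (forall x, rnorm (S x) <= rnorm (T x)) ->
  (schatten_sum p T < +oo)%E -> schatten_sum p S = schatten_sum p T ->
  forall x, rnorm (S x) = rnorm (T x).
Proof.
move=> p1 bS bT cS cT ST fT eST.
have [pS _] := abs_opP bS; have [pT _] := abs_opP bT.
have p0 : 0 < p by apply: lt_le_trans p1.
have le_ST := abs_op_le bS bT ST.
suff D0 x : abs_op T x = abs_op S x.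
  by move=> x; rewrite -(abs_op_norm x bS) -(abs_op_norm x bT) D0.
pose D := abs_op T \- abs_op S.
have pD : positive_op D.
  apply: positiveI => [|y z|y] /=; first exact: bop_sub (positive_bop pT) (positive_bop pS).
    by rewrite rdotBl rdotBr !positive_sa.
  by rewrite rdotBl subr_ge0 le_ST.
apply/eqP; rewrite -subr_eq0; apply/eqP.
apply: (ortho_eigenvectors pS (modulus_clusteringE bS cS)) => f ef.
rewrite -[_ - _]/(D x) positive_innerC //.
suff -> : D f = 0 by exact: linear0r.
apply: positive_eq0 => //; apply/eqP; apply: contraT => Df.
have nf : 0 < rnorm f.
  by rewrite rnorm_gt0; apply: contraNneq Df => ->; rewrite rdot0r.
pose e := (rnorm f)^-1%:C *: f.
have e1 : rnorm e = 1 by rewrite rnormZ ger0_norm ?invr_ge0 // mulVf // gt_eqF.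
have ee : eigenvectors (abs_op S) e.
  have [l Sf] := ef; exists l.
  by rewrite /e (opZ (bop_lin (positive_bop pS))) Sf !scalerA mulrC.
have De : quad (abs_op S) e < quad (abs_op T) e.
  rewrite lt_neqAle le_ST andbT eq_sym -subr_eq0 /quad -rdotBl.
  rewrite -[_ - _]/(D e) /e (opZ (bop_lin (positive_bop pD))) rdotZl rdotZr.
  by rewrite !mulf_neq0 // invr_neq0 // gt_eqF.
(* The gap between the two sums. *)
pose c := quad (abs_op T) e `^ p - quad (abs_op S) e `^ p.
have c0 : 0 < c.
  by rewrite subr_gt0; apply: gt0_ltr_powR => //; rewrite nnegrE positive_ge0.
move: fT; have := eigensum_ge0 p (abs_op T); rewrite -[eigensum _ _]/(schatten_sum p T).
case E : (schatten_sum p T) => [sg| |] // _ _.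
have : (schatten_sum p S <= (sg - c)%:E)%E.
  apply: (@eigensum_le _ _ _ _ [:: e]) => [//||t [os _]].
    by split; [exact/orthonormal_consP|move=> y; rewrite inE => /eqP ->].
  have : powsum p (abs_op T) ([:: e] ++ t) <= sg.
    by rewrite -lee_fin -E; exact: powsum_le_schatten.
  have : powsum p (abs_op S) t <= powsum p (abs_op T) t.
    by apply: powsum_mono => //; exact: ltW.
  by rewrite /powsum /= !big_cons -/(powsum _ _ _) -/(powsum _ _ _) /c; lra.
by rewrite eST E lee_fin; lra.
Qed.

(** [T] maps the eigenspaces of its modulus for nonzero eigenvalues injectively into
    those of the modulus of its adjoint. *)
Lemma schatten_sum_adj p T : bounded_op T ->
  (schatten_sum p T <= schatten_sum p (adjoint_op T))%E.
Proof.
move=> bT; have bTa := adjoint_bop bT; have lT := bop_lin bT; have lTa := bop_lin bTa.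
have [pT eT] := abs_opP bT; have [pTa eTa] := abs_opP bTa.
have TT : adjoint_op (adjoint_op T) = T.
  apply: adjoint_op_eq => // x y.
  by have [_ h] := adjoint_opP bT; rewrite innerC -h -innerC.
rewrite TT in eTa.
apply: le_esum => l /= l0; apply: lee_wpmul2r; first by rewrite lee_fin powR_ge0.
apply: le_ereal_sup => _ [n [e [eV ie]] <-]; exists n => //.
have TTe i : adjoint_op T (T (e i)) = (l ^+ 2)%:C *: e i.
  rewrite -[LHS]/((adjoint_op T \o T) (e i)) -eT /= eV.
  by rewrite (opZ (bop_lin (positive_bop pT))) eV scalerA -rmorphM.
exists (T \o e); split=> [i|c c0].
  apply: positive_sq_eigen => //.
  by rewrite -[LHS]/((abs_op (adjoint_op T) \o abs_op (adjoint_op T)) _) eTa /= TTe (opZ lT).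
apply: ie; have := congr1 (adjoint_op T) c0; rewrite (op0 lTa).
rewrite (big_morph _ (opD lTa) (op0 lTa)).
have -> : \sum_i adjoint_op T (c i *: (T \o e) i) = (l ^+ 2)%:C *: \sum_i c i *: e i.
  rewrite scaler_sumr; apply: eq_bigr => i _.
  by rewrite (opZ lTa) /= TTe !scalerA mulrC.
move/eqP; rewrite scaler_eq0 => /orP[|/eqP //].
by rewrite eq_complex /= eqxx andbT sqrf_eq0 gt_eqF.
Qed.

Lemma adjoint_comp S T : bounded_op S -> bounded_op T ->
  adjoint_op (S \o T) = adjoint_op T \o adjoint_op S.
Proof.
move=> bS bT; have [_ hS] := adjoint_opP bS; have [_ hT] := adjoint_opP bT.
by apply: adjoint_op_eq => [|x y /=]; [exact: bop_comp|rewrite hS hT].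
Qed.

Lemma modulus_clustering_comp Y Q Z : compact_op Q -> bounded_op Y -> bounded_op Z ->
  modulus_clustering (Y \o Q \o Z).
Proof.
move=> cQ bY bZ; have bQ : bounded_op Q by case: cQ.
have bT : bounded_op (Y \o Q \o Z) by apply: bop_comp => //; exact: bop_comp.
exact: (@compact_clustering _ _ Q (adjoint_op (Y \o Q \o Z) \o Y) Z cQ
  (bop_comp (adjoint_bop bT) bY) bZ).
Qed.

(** The pointwise bounds that control a Schatten sum see factors on the left only;
    passing to the adjoint turns the right factor [Z] into a left one. *)
Lemma schatten_sum_comp_fin p Q Z : 1 <= p -> positive_op Q -> compact_op Q ->
  bounded_op Z -> (schatten_sum p Q < +oo)%E -> (schatten_sum p (Q \o Z) < +oo)%E.
Proof.
move=> p1 pQ cQ bZ fQ; have bQ := positive_bop pQ; have lQ := bop_lin bQ.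
have p0 : 0 < p by apply: lt_le_trans p1.
have [M M0 hM] := bop_bound (adjoint_bop bZ).
(* With M a bound for the adjoint of Z, the adjoint of Q \o Z is pointwise
   dominated by M Q, whose eigenvectors are those of Q. *)
pose MQ x := M%:C *: Q x.
have bMQ : bounded_op MQ by exact: bop_scale.
have pMQ : positive_op MQ.
  apply: positiveI => // [x y|x]; first by rewrite /MQ rdotZl rdotZr positive_sa.
  by rewrite /MQ rdotZl mulr_ge0 ?(ltW M0) ?positive_ge0.
have cMQ : modulus_clustering MQ.
  exact: (@modulus_clustering_comp (fun x => M%:C *: x) Q id cQ
    (bop_scale _ (@bop_id _ _)) (@bop_id _ _)).
have bQZ := bop_comp bQ bZ.
apply: (@le_lt_trans _ _ (schatten_sum p MQ)).
  apply: (le_trans (schatten_sum_adj p bQZ)).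
  rewrite adjoint_comp // (positive_adj pQ); apply: schatten_sum_mono => //.
    by apply: bop_comp => //; exact: adjoint_bop.
  by move=> x; rewrite /MQ rnormZ gtr0_norm //; exact: hM.
have := eigensum_ge0 p (abs_op Q); move: fQ; rewrite -[eigensum _ _]/(schatten_sum p Q).
case E : (schatten_sum p Q) => [sg| |] // _ _.
apply: (@le_lt_trans _ _ (M `^ p * sg)%:E); last by rewrite ltry.
rewrite -[schatten_sum p MQ]/(eigensum p (abs_op MQ)) abs_op_pos //.
apply: (@eigensum_le _ _ _ _ [::]) => [//||t [os es]]; first by split.
have -> : powsum p MQ ([::] ++ t) = M `^ p * powsum p Q t.
  rewrite /powsum mulr_sumr; apply: eq_bigr => e _.
  by rewrite /quad /MQ rdotZl powRM ?(ltW M0) ?positive_ge0.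
rewrite ler_wpM2l ?powR_ge0 // -lee_fin -E /schatten_sum abs_op_pos //.
apply: powsum_le_eigensum => //; split=> // e /es[l el]; exists (l / M).
have -> : Q e = (M^-1)%:C *: MQ e.
  by rewrite /MQ scalerA -rmorphM /= mulVf ?scale1r // gt_eqF.
by rewrite el scalerA -rmorphM mulrC.
Qed.

End Comparison.

(** * Uniform boundedness and closed graphs *)

Section Closure.
Context {R : realType} {H : hilbertType R}.
Implicit Types (S T U Q X Y Z : H -> H) (x y z w g h e f : H) (r l p : R).

(** The closure of the range of [T], in a form whose closedness needs no diagonal
    sequence. *)
Definition range_closure T : set H :=
  [set y | forall e : R, 0 < e -> exists x, rnorm (T x - y) <= e].

Lemma range_closure_range T x : range_closure T (T x).
Proof. by move=> e e0; exists x; rewrite subrr rnorm0 ltW. Qed.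

Lemma hsubspace_range_closure T : linear T -> hsubspace (range_closure T).
Proof.
move=> lT; split=> [|x y hx hy e e0|a x hx e e0|u l hu ul e e0].
- by rewrite -(op0 lT); exact: range_closure_range.
- have [x' h1] := hx (e / 2) ltac:(lra); have [y' h2] := hy (e / 2) ltac:(lra).
  by exists (x' + y'); rewrite (opD lT) opprD addrACA (le_trans (rnormD _ _)) //; lra.
- have [M M0 hM] := bop_bound (bop_scale a (@bop_id R H)).
  have [x' h1] := hx (e / M) ltac:(by rewrite divr_gt0).
  exists (a *: x'); rewrite (opZ lT) -scalerBr (le_trans (hM _)) //.
  by rewrite mulrC -ler_pdivlMr.
- have [N hN] := ul (e / 2) ltac:(lra); have [x' h1] := hu N (e / 2) ltac:(lra).
  exists x'; have -> : T x' - l = (T x' - u N) + (u N - l) by rewrite addrA subrK.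
  by have h2 := hN N (leqnn _); rewrite (le_trans (rnormD _ _)) //; lra.
Qed.

Lemma rdot0_inner (V : set H) x : hsubspace V -> (forall w, V w -> rdot x w = 0) ->
  forall w, V w -> inner x w = 0.
Proof. by move=> [_ _ VZ _] h w Vw; apply/inner_rdot0; rewrite !h //; exact: VZ. Qed.

Lemma ortho_range_closure T x w : linear T -> (forall y, inner x (T y) = 0) ->
  range_closure T w -> inner x w = 0.
Proof.
move=> lT h; apply: rdot0_inner => [|{}w hw]; first exact: hsubspace_range_closure.
apply/eqP; rewrite -normr_eq0 eq_le normr_ge0 andbT.
apply: (@small_le0 _ _ (rnorm x + 1)) => [|e e0 e1]; first by rewrite ltr_wpDl.
have [y hy] := hw e e0; have /inner_rdot0[xTy _] := h y.
have -> : rdot x w = - rdot x (T y - w) by rewrite rdotBr xTy; ring.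
rewrite normrN (le_trans (rdot_CS _ _)) // ler_pM // ?lerDl //.
Qed.

(** A gliding hump. Were the norms unbounded, choose [w n] in [F] of norm more than
    [2 n 3^n] and move by steps of length [3^-n] in the directions [w n], with
    signs such that each step enlarges the product with [w n]. The limit [l]
    keeps at least half of that gain, so [|rdot l (w n)|] exceeds [n]. *)
Lemma uniform_boundedness (F : set H) :
  (forall x, exists M, forall w, F w -> `|rdot x w| <= M) ->
  exists M, forall w, F w -> rnorm w <= M.
Proof.
move=> Fpt; apply: contrapT => hF.
have /choice[w hw] n : exists w, F w /\ 2 * n%:R * 3 ^+ n < rnorm w.
  apply: contrapT => hn; apply: hF; exists (2 * n%:R * 3 ^+ n) => v Fv.
  by rewrite leNgt; apply/negP => ?; apply: hn; exists v.
pose d n : R := (3 ^+ n)^-1.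
have d0 n : 0 < d n by rewrite invr_gt0 exprn_gt0.
have dS n : d n = 3 * d n.+1 by rewrite /d exprS; field; rewrite expf_neq0.
have w0 n : 0 < rnorm (w n).
  by have [_] := hw n; apply: le_lt_trans; rewrite !mulr_ge0 // exprn_ge0.
pose sgn r : R := if 0 <= r then 1 else -1.
pose fix x n : H := if n is m.+1 then
  x m + (sgn (rdot (x m) (w m)) * d m / rnorm (w m))%:C *: w m else 0.
have xS n : x n.+1 = x n + (sgn (rdot (x n) (w n)) * d n / rnorm (w n))%:C *: w n by [].
have sgn1 r : `|sgn r| = 1 by rewrite /sgn; case: ifP; rewrite ?normrN normr1.
have sgnM r : sgn r * r = `|r|.
  by rewrite /sgn; case: lerP => [/ger0_norm ->|/ltr0_norm ->]; rewrite ?mul1r ?mulN1r.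
have step n : rnorm (x n.+1 - x n) <= d n.
  rewrite xS addrC addKr rnormZ !normrM sgn1 mul1r !gtr0_norm ?invr_gt0 //.
  by rewrite divfK // gt_eqF.
have dist : forall n k, rnorm (x (n + k)%N - x n) <= 3 / 2 * (d n - d (n + k)%N).
  move=> n; elim=> [|k IH]; first by rewrite addn0 !subrr rnorm0 mulr0.
  have -> : x (n + k.+1)%N - x n = (x (n + k).+1 - x (n + k)%N) + (x (n + k)%N - x n).
    by rewrite addnS addrA subrK.
  rewrite (le_trans (rnormD _ _)) // (le_trans (lerD (step _) IH)) //.
  by rewrite addnS (dS (n + k)%N); lra.
have dist' n m : (n <= m)%N -> rnorm (x m - x n) <= 3 / 2 * d n.
  move=> nm; rewrite -(subnKC nm) (le_trans (dist _ _)) //.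
  by have := d0 (n + (m - n))%N; lra.
have dsmall n : d n <= n.+1%:R^-1.
  by rewrite /d lef_pV2 ?posrE ?exprn_gt0 // -natrX ler_nat ltn_expl.
have [|l xl] := @hilbert_complete _ _ x.
  move=> e e0; have [N hN] := invS_small (divr_gt0 e0 (ltr0n R 3)).
  exists N => m n Nm Nn.
  have -> : x m - x n = (x m - x N) - (x n - x N) by rewrite opprB addrA subrK.
  rewrite (le_trans (rnormB _ _)) // (le_trans (lerD (dist' _ _ Nm) (dist' _ _ Nn))) //.
  have := le_trans (dsmall N) (hN N (leqnn _)); lra.
have [M hM] := Fpt l.
pose n := (Num.truncn `|M|).+1.
have Mn : M < n%:R by rewrite (le_lt_trans (ler_norm _)) // truncnS_gt.
have [Fw wn] := hw n; have := hM _ Fw; apply/negP; rewrite -ltNge (lt_le_trans Mn) //.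
have h1 : d n * rnorm (w n) <= `|rdot (x n.+1) (w n)|.
  rewrite xS rdotDl rdotZl rdot_norm.
  have -> : sgn (rdot (x n) (w n)) * d n / rnorm (w n) * rnorm (w n) ^+ 2 =
    sgn (rdot (x n) (w n)) * (d n * rnorm (w n)) by rewrite expr2 mulrA divfK ?gt_eqF // mulrA.
  set r := rdot _ _; set b := d n * _.
  have b0 : 0 <= b by rewrite mulr_ge0 ?(ltW (d0 n)).
  rewrite -[leRHS]mul1r -(sgn1 r) -normrM mulrDr mulrA sgnM (le_trans _ (ler_norm _)) //.
  have -> : sgn r * sgn r = 1 by rewrite /sgn; case: ifP; rewrite ?mulrNN mulr1.
  by rewrite mul1r lerDr.
have h2 : rnorm (l - x n.+1) <= d n / 2.
  rewrite (tends_rnorm_le (N := n.+1) xl) // => m nm.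
  by rewrite (le_trans (dist' _ _ nm)) // (dS n); lra.
have h3 : `|rdot (l - x n.+1) (w n)| <= d n / 2 * rnorm (w n).
  by rewrite (le_trans (rdot_CS _ _)) // ler_wpM2r.
have h4 : n%:R <= d n / 2 * rnorm (w n).
  rewrite mulrAC ler_pdivlMr // /d [leRHS]mulrC ler_pdivlMr ?exprn_gt0 //.
  by rewrite [n%:R * 2]mulrC ltW.
have : rdot (x n.+1) (w n) = rdot l (w n) - rdot (l - x n.+1) (w n).
  by rewrite rdotBl; ring.
have := ler_normB (rdot l (w n)) (rdot (l - x n.+1) (w n)).
by move=> h5 h6; move: h1; rewrite h6; lra.
Qed.

(** Closed graph theorem for the solutions of [C (X x) = E x]. For [|C v| <= 1] the
    products [rdot (X x) (C v) = rdot x (adjoint_op E v)] are bounded at each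
    [x], hence the vectors [adjoint_op E v] are bounded by some [M]. As [X x]
    lies in the closure of the range of [C], this bounds its norm by
    [M * rnorm x]. *)
Lemma solution_bounded C E X : positive_op C -> bounded_op E -> linear X ->
  (forall x, C (X x) = E x) -> (forall x y, C y = 0 -> inner (X x) y = 0) ->
  bounded_op X.
Proof.
move=> pC bE lX CX Xk; have bC := positive_bop pC; have lC := bop_lin bC.
have key x v : rdot (X x) (C v) = rdot x (adjoint_op E v).
  by rewrite -positive_sa // CX rdot_adj.
have [|M hM] := @uniform_boundedness [set adjoint_op E v | v in [set v | rnorm (C v) <= 1]].
  move=> x; exists (rnorm (X x)) => _ [v /= v1 <-].
  by rewrite -key (le_trans (rdot_CS _ _)) // ler_piMr.
have hM' x v : rdot (X x) (C v) <= `|M| * rnorm x * rnorm (C v).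
  have [->|Cv] := eqVneq (C v) 0; first by rewrite rdot0r rnorm0 mulr0.
  have nC : 0 < rnorm (C v) by rewrite rnorm_gt0.
  pose v' := (rnorm (C v))^-1%:C *: v.
  have : rnorm (adjoint_op E v') <= M.
    apply: hM; exists v' => //=; rewrite /v' (opZ lC) rnormZ ger0_norm ?invr_ge0 //.
    by rewrite mulVf // gt_eqF.
  have : rdot (X x) (C v') <= rnorm x * rnorm (adjoint_op E v') by rewrite key rdot_le.
  rewrite /v' (opZ lC) rdotZr -/v' ler_pdivrMl // => h1 h2; rewrite (le_trans h1) //.
  rewrite mulrC ler_wpM2r // mulrC ler_wpM2r // (le_trans h2) // ler_norm //.
apply: (@bopI _ _ _ `|M|) => // x.
set y := X x.
have [P [bP VP iP]] := proj_exists (hsubspace_range_closure lC).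
(* y - P y is orthogonal to the range of C, hence in the kernel of C, to which
   y is orthogonal. *)
have yP : P y = y.
  pose z := y - P y.
  have Cz : C z = 0.
    apply: rdot_inj => v; rewrite positive_sa // rdot0l /z rdotBl.
    by rewrite /rdot iP ?subrr //; exact: range_closure_range.
  have zz : rdot z z = 0.
    have yz : rdot y z = 0 by rewrite /rdot Xk.
    have : rdot z (P y) = 0.
      by rewrite /z rdotBl {2}/rdot iP // subrr.
    by rewrite {2}/z rdotBr (rdotC z y) yz => ->; rewrite subrr.
  by move/rdot_eq0/eqP: zz; rewrite subr_eq0 => /eqP.
have hy : range_closure C y by rewrite -yP; exact: VP.
have : rnorm y ^+ 2 <= `|M| * rnorm x * rnorm y.
  rewrite -subr_le0; apply: (@small_le0 _ _ (`|M| * rnorm x + rnorm y + 1)) => [|e e0 e1].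
    by rewrite ltr_wpDl // addr_ge0 // mulr_ge0.
  have [v hv] := hy e e0.
  have h1 : rdot y y = rdot y (C v) - rdot y (C v - y) by rewrite rdotBr; ring.
  have h2 : - rdot y (C v - y) <= rnorm y * e.
    rewrite -rdotNr (le_trans (rdot_le _ _)) // ler_wpM2l // rnormN //.
  have h3 : rnorm (C v) <= rnorm y + e.
    have -> : C v = y + (C v - y) by rewrite addrC subrK.
    by rewrite (le_trans (rnormD _ _)) // lerD2l.
  have h4 : rdot y (C v) <= `|M| * rnorm x * (rnorm y + e).
    by rewrite (le_trans (hM' x v)) // ler_wpM2l // mulr_ge0.
  rewrite -rdot_norm h1; lra.
rewrite expr2; have [->|y0] := eqVneq (rnorm y) 0; first by rewrite mulr_ge0.
by rewrite ler_pM2r // lt_neqAle eq_sym y0 rnorm_ge0.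
Qed.

End Closure.

(** * The shorted operator *)

Section Shorted.
Context {R : realType} {H : hilbertType R}.
Implicit Types (S T U Q X Y Z A B W P : H -> H) (x y z w g h e f : H) (r l p : R).

Lemma op_le_anti S T : op_le S T -> op_le T S -> S = T.
Proof.
move=> ST TS; apply/funext => x; apply/eqP; rewrite -subr_eq0; apply/eqP.
apply: (positive_eq0 TS); apply/eqP; rewrite eq_le (positive_ge0 x TS) andbT.
by have /= := positive_ge0 x ST; rewrite !rdotBl; lra.
Qed.

(** [P] is the projection onto the orthocomplement of the range of [T], given as the
    complement of the projection [P'] onto the closure of the range. *)
Definition ortho_projection T P := bounded_op P /\
  exists2 P', forall x, P x = x - P' x &
    [/\ bounded_op P', forall x, range_closure T (P' x) &
      forall x w, range_closure T w -> inner (P' x) w = inner x w].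

Lemma ortho_projection_exists T : linear T -> exists P, ortho_projection T P.
Proof.
move=> lT; have [P' [bP' VP' iP']] := proj_exists (hsubspace_range_closure lT).
exists (id \- P'); split; first exact: bop_sub (@bop_id _ _) bP'.
by exists P'.
Qed.

Lemma ortho_projection_ortho T P x w : ortho_projection T P -> range_closure T w ->
  inner (P x) w = 0.
Proof. by move=> [_ [P' -> [_ _ iP']]] Tw; rewrite innerBl iP' // subrr. Qed.

Lemma ortho_projection_fix T P x : linear T -> ortho_projection T P ->
  (forall y, inner x (T y) = 0) -> P x = x.
Proof.
move=> lT [_ [P' -> [_ VP' iP']]] h; have /inner_rdot0[P'0 _] : inner x (P' x) = 0.
  exact: (ortho_range_closure lT h (VP' x)).
have -> : P' x = 0.
  by apply: rdot_eq0; rewrite /rdot iP' // -/(rdot _ _).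
by rewrite subr0.
Qed.

Lemma ortho_projection_range T P y : ortho_projection T P -> P (T y) = 0.
Proof.
move=> oP; apply: rdot_eq0; have [_ [P' eP [_ VP' iP']]] := oP.
rewrite {2}eP rdotBr /rdot !(ortho_projection_ortho _ oP) ?subrr //.
exact: range_closure_range.
Qed.

Lemma ortho_projection_pythagoras T P x : ortho_projection T P ->
  rnorm x ^+ 2 = rnorm (P x) ^+ 2 + rnorm (x - P x) ^+ 2.
Proof.
move=> oP; have [_ [P' eP [_ VP' iP']]] := oP.
have /inner_rdot0[PP' _] := ortho_projection_ortho x oP (VP' x).
have {1}-> : x = P x + P' x by rewrite eP subrK.
rewrite rnorm_sqD PP' mulr0 addr0; congr (_ + rnorm _ ^+ 2).
by rewrite eP opprB addrC subrK.
Qed.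

Lemma ortho_projection_le T P x : ortho_projection T P -> rnorm (P x) <= rnorm x.
Proof.
move=> oP; rewrite -ler_sqr ?nnegrE ?rnorm_ge0 //.
by rewrite [leRHS](ortho_projection_pythagoras x oP) lerDl sqr_ge0.
Qed.

Lemma ortho_projection_rdot T P x : ortho_projection T P -> rdot (P x) x = rnorm (P x) ^+ 2.
Proof.
move=> oP; have [_ [P' eP [_ VP' iP']]] := oP.
have /inner_rdot0[PP' _] := ortho_projection_ortho x oP (VP' x).
have {2}-> : x = P x + P' x by rewrite eP subrK.
by rewrite rdotDr PP' addr0 rdot_norm.
Qed.

Lemma ortho_projection_positive T P : ortho_projection T P -> positive_op P.
Proof.
move=> oP; apply: positiveI => [|x y|x]; first by case: oP.
- have [_ [P' eP [_ VP' iP']]] := oP.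
  have h a b : rdot (P a) b = rdot (P a) (P b).
    have /inner_rdot0[PP' _] := ortho_projection_ortho a oP (VP' b).
    have {1}-> : b = P b + P' b by rewrite eP subrK.
    by rewrite rdotDr PP' addr0.
  by rewrite (h x y) (rdotC x (P y)) (h y x) rdotC.
- by rewrite (ortho_projection_rdot x oP) sqr_ge0.
Qed.

(** [Q P Q] is a candidate since [P] kills [Q (range A)]. It is the largest one: a
    candidate [Y] vanishes on the range of [A], hence
    [<Y x, x> = <Y (x - A m), x - A m> <= |Q x - Q (A m)|^2] for all [m], and the
    infimum of the right-hand side is [|P (Q x)|^2]. *)
Lemma shortedE W A P : positive_op W -> bounded_op A ->
  ortho_projection (sqrt_op W \o A) P ->
  shorted W (range A) = sqrt_op W \o P \o sqrt_op W.
Proof.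
move=> pW bA oP; set Q := sqrt_op W; have [pQ QQ] := sqrt_opP pW; rewrite -/Q in pQ QQ.
have bQ := positive_bop pQ; have lQ := bop_lin bQ; have lA := bop_lin bA.
have pP := ortho_projection_positive oP; have bP := positive_bop pP.
have lQA : linear (Q \o A) by apply: bop_lin; exact: bop_comp.
pose X := Q \o P \o Q; rewrite -/X.
have bX : bounded_op X by apply: bop_comp => //; exact: bop_comp.
have qX x : rdot (X x) x = rnorm (P (Q x)) ^+ 2.
  by rewrite /X /= positive_sa // (ortho_projection_rdot _ oP).
have Wq x : rdot (W x) x = rnorm (Q x) ^+ 2 by rewrite -QQ /= positive_sa // rdot_norm.
have pX : positive_op X.
  apply: positiveI => // [x y|x]; last by rewrite qX sqr_ge0.
  by rewrite /X /= positive_sa // positive_sa // positive_sa.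
have cX : shorted_candidate W (range A) X.
  split=> //.
    apply: positiveI => [|x y|x] /=; first exact: bop_sub (positive_bop pW) bX.
      by rewrite rdotBl rdotBr !positive_sa.
    rewrite rdotBl qX Wq subr_ge0 ler_sqr ?nnegrE ?rnorm_ge0 //.
    exact: ortho_projection_le oP.
  move=> _ [x _ <-] _ [y _ <-]; rewrite /X /= positive_innerC //.
  apply: (ortho_projection_ortho _ oP); exact: range_closure_range.
have mX Y : shorted_candidate W (range A) Y -> op_le Y X.
  move=> [pY YW rY]; have bY := positive_bop pY; have lY := bop_lin bY.
  apply: positiveI => [|x y|x] /=; first exact: bop_sub.
    by rewrite rdotBl rdotBr !positive_sa.
  rewrite rdotBl subr_ge0 qX -subr_le0.
  have YA m : Y (A m) = 0.
    apply: rdot_inj => w; rewrite rdot0l positive_sa // rdotC.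
    have /inner_rdot0[] // : inner (Y w) (A m) = 0.
    by apply: rY; [exists w|exists m].
  have [_ [P' eP [_ VP' _]]] := oP.
  apply: (@small_le0 _ _ (2 * rnorm (P (Q x)) + 1)) => [|e e0 e1].
    by rewrite ltr_wpDl // mulr_ge0.
  have [m hm] := VP' (Q x) e e0.
  have Yx : rdot (Y x) x = rdot (Y (x - A m)) (x - A m).
    by rewrite (opB lY) YA subr0 rdotBr (positive_sa x (A m)) // YA rdot0r subr0.
  have YQ : rdot (Y x) x <= rnorm (Q (x - A m)) ^+ 2.
    by rewrite Yx -Wq -subr_ge0 -rdotBl; exact: (positive_ge0 (x - A m) YW).
  have : rnorm (Q (x - A m)) <= rnorm (P (Q x)) + e.
    have -> : Q (x - A m) = P (Q x) - ((Q \o A) m - P' (Q x)).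
      by rewrite eP (opB lQ) opprB addrA subrK.
    by rewrite (le_trans (rnormB _ _)) // lerD2l.
  have := rnorm_ge0 (Q (x - A m)); have := rnorm_ge0 (P (Q x)).
  move: YQ; move: (rdot _ _) (rnorm _) (rnorm _) => a c b h1 c0 b0 h2.
  have : b ^+ 2 <= (c + e) ^+ 2 by rewrite ler_sqr ?nnegrE ?addr_ge0 ?(ltW e0).
  have : e ^+ 2 <= e by rewrite expr2 ler_piMr // ltW.
  by rewrite sqrrD; lra.
have [c1 m1] : shorted_candidate W (range A) (shorted W (range A)) /\
    forall Y, shorted_candidate W (range A) Y -> op_le Y (shorted W (range A)).
  apply: (@getPex _ [set X | shorted_candidate W (range A) X /\
               forall Y, shorted_candidate W (range A) Y -> op_le Y X]).
  by exists X.
by apply: op_le_anti; [exact: mX|exact: m1].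
Qed.

Lemma bop_rank1 T u v : bounded_op T -> bounded_op (fun x => inner (T x) u *: v).
Proof.
move=> bT; have [M M0 hM] := bop_bound bT; have lT := bop_lin bT.
apply: (@bopI _ _ _ (2 * M * rnorm u * rnorm v)) => [a x y|x].
  by rewrite lT innerDl innerZl scalerDl scalerA.
have -> : inner (T x) u *: v = (rdot (T x) u)%:C *: v + (rdot (T x) ('i *: u))%:C *: ('i *: v).
  rewrite scalerA -scalerDl; congr (_ *: _); rewrite innerE.
  by apply/eqP; rewrite eq_complex /= !mul0r !mulr0 !mulr1 !subr0 !addr0 !add0r !eqxx.
have h w : rnorm w = rnorm u -> `|rdot (T x) w| <= M * rnorm x * rnorm u.
  by move=> wu; rewrite (le_trans (rdot_CS _ _)) // wu ler_wpM2r.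
rewrite (le_trans (rnormD _ _)) // !rnormZ rnormi.
have := ler_wpM2r (rnorm_ge0 v) (h u erefl); have := ler_wpM2r (rnorm_ge0 v) (h _ (rnormi u)).
lra.
Qed.

Lemma seminormWE W x : positive_op W -> seminormW W x = (rnorm (sqrt_op W x))%:C.
Proof.
move=> pW; have [pQ QQ] := sqrt_opP pW.
have -> : seminormW W x = sqrtC (inner (sqrt_op W x) (sqrt_op W x)).
  by rewrite -positive_innerC // -[sqrt_op W (sqrt_op W x)]/((sqrt_op W \o sqrt_op W) x) QQ.
by rewrite inner_norm rnormE sqrCK // ler0c.
Qed.

End Shorted.

(** * Residuals of the weighted approximation problem *)

Section Approximation.
Context {R : realType} {H : hilbertType R}.
Variables (A B W : H -> H).
Hypotheses (bA : bounded_op A) (bB : bounded_op B) (pW : positive_op W).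
Let Q := sqrt_op W.
Implicit Types (x y z w : H) (X : H -> H) (p r : R).

Definition range_condition :=
  range B `<=` sum_set (range A) (orthoW W (range A)).

Definition weighted_error X : H -> H := Q \o ((A \o X) \- B).

Lemma inner_sqrtW x y : inner (W x) y = inner (Q x) (Q y).
Proof.
by have [pQ QQ] := sqrt_opP pW; rewrite -positive_innerC // -{1}QQ.
Qed.

Lemma bop_sqrtW : bounded_op Q.
Proof. by have [/positive_bop] := sqrt_opP pW. Qed.

Lemma weighted_error_bop X : bounded_op X -> bounded_op (weighted_error X).
Proof.
by move=> bX; apply: bop_comp bop_sqrtW _; apply: bop_sub => //; exact: bop_comp.
Qed.

(** If all residuals are orthogonal to [Q (range A)], then
    [B x = A (X0 x) + (B x - A (X0 x))] is the required decomposition. *)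
Lemma range_condition_of X0 :
  (forall x y, inner (weighted_error X0 x) (Q (A y)) = 0) -> range_condition.
Proof.
move=> h _ [x _ <-]; exists (A (X0 x)); first by exists (X0 x).
exists (B x - A (X0 x)); last by rewrite addrC subrK.
move=> _ [y _ <-]; rewrite inner_sqrtW -opprB (opN (bop_lin bop_sqrtW)).
by rewrite innerNl -[Q _]/(weighted_error X0 x) h oppr0.
Qed.

(** Remove from the residual its component along the unit vector [q] proportional to
    [Q (A y0)], by a rank one modification of [X0]. *)
Lemma error_descent X0 x0 y0 : bounded_op X0 ->
  inner (weighted_error X0 x0) (Q (A y0)) != 0 ->
  exists X, [/\ bounded_op X,
    forall x, rnorm (weighted_error X x) <= rnorm (weighted_error X0 x) &
    rnorm (weighted_error X x0) < rnorm (weighted_error X0 x0)].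
Proof.
move=> bX0 h; have bQ := bop_sqrtW; have lQ := bop_lin bQ; have lA := bop_lin bA.
set T0 := weighted_error X0 in h *.
have nq : 0 < rnorm (Q (A y0)).
  rewrite rnorm_gt0; apply: contraNneq h => ->; apply/eqP; exact: linear0r.
pose y := (rnorm (Q (A y0)))^-1%:C *: y0.
have qy : Q (A y) = (rnorm (Q (A y0)))^-1%:C *: Q (A y0).
  by rewrite /y (opZ lA) (opZ lQ).
set q := Q (A y) in qy.
have q1 : rnorm q = 1 by rewrite qy rnormZ ger0_norm ?invr_ge0 // mulVf // gt_eqF.
have hq : inner (T0 x0) q != 0.
  rewrite qy innerZr conjc_real mulf_neq0 //.
  by rewrite eq_complex /= eqxx andbT invr_eq0 gt_eqF.
pose X := X0 \- (fun x => inner (T0 x) q *: y).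
have bX : bounded_op X by apply: bop_sub => //; apply: bop_rank1; exact: weighted_error_bop.
have TX x : weighted_error X x = T0 x - inner (T0 x) q *: q.
  rewrite /weighted_error /X /= (opB lA) (opZ lA) addrAC (opB lQ).
  by rewrite (opZ lQ).
have pyth x : rnorm (T0 x) ^+ 2 = weight (T0 x) q + rnorm (weighted_error X x) ^+ 2.
  have oq : orthonormal inner [:: q] by apply/orthonormal_consP.
  by rewrite (norm_expand (T0 x) oq) big_seq1 /= TX.
exists X; split=> // [x|].
  by rewrite -ler_sqr ?nnegrE ?rnorm_ge0 // [leRHS]pyth lerDr weight_ge0.
rewrite -ltr_sqr ?nnegrE ?rnorm_ge0 // [ltRHS]pyth ltrDr lt_neqAle weight_ge0 andbT.
apply: contraNneq hq => w0; rewrite innerE; move/eqP: w0; rewrite eq_sym /weight.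
by rewrite paddr_eq0 ?sqr_ge0 // !sqrf_eq0 => /andP[/eqP -> /eqP ->].
Qed.

Variable P : H -> H.
Hypothesis oP : ortho_projection (Q \o A) P.

(** The part of the residual that no choice of [X] can change. *)
Definition optimal_error : H -> H := P \o Q \o B.

Lemma optimal_error_bop : bounded_op optimal_error.
Proof.
apply: bop_comp => //; apply: bop_comp bop_sqrtW.
exact/positive_bop/(ortho_projection_positive oP).
Qed.

Lemma projection_error X x : P (weighted_error X x) = - optimal_error x.
Proof.
have lP := bop_lin (positive_bop (ortho_projection_positive oP)).
have lQ := bop_lin bop_sqrtW.
rewrite /weighted_error /optimal_error /= (opB lQ) (opB lP).
by rewrite -[Q (A _)]/((Q \o A) _) (ortho_projection_range _ oP) sub0r.
Qed.

Lemma optimal_error_le X x : rnorm (optimal_error x) <= rnorm (weighted_error X x).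
Proof.
by rewrite -[leLHS]rnormN -(projection_error X) (ortho_projection_le _ oP).
Qed.

(** The range condition makes the normal equation [C y = E x] solvable. At its
    solutions the residual is orthogonal to [Q (range A)], hence it is equal to
    its projection, the optimal error up to sign. *)
Lemma optimal_error_attained : range_condition -> exists2 X, bounded_op X &
  forall x, rnorm (weighted_error X x) = rnorm (optimal_error x).
Proof.
move=> rc; have bQ := bop_sqrtW; have lQ := bop_lin bQ; have lA := bop_lin bA.
have bW := positive_bop pW; have lW := bop_lin bW.
have bA' := adjoint_bop bA; have lA' := bop_lin bA'; have lB := bop_lin bB.
have hA x z : inner (A x) z = inner x (adjoint_op A z) by case: (adjoint_opP bA).
have hA' x z : inner (adjoint_op A x) z = inner x (A z) by rewrite innerC -hA -innerC.
pose C := adjoint_op A \o W \o A.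
pose E := adjoint_op A \o W \o B.
have bC : bounded_op C by apply: bop_comp => //; exact: bop_comp.
have bE : bounded_op E by apply: bop_comp => //; exact: bop_comp.
have lC := bop_lin bC; have lE := bop_lin bE.
have pC : positive_op C.
  apply: positiveI => // [x y|x] /=.
    by rewrite rdot_adjl // positive_sa // rdot_adj.
  by rewrite rdot_adjl // positive_ge0.
have [P' [bP' VP' iP']] := proj_exists (hsubspace_ker bC).
have /choice[X hX] x : exists y, C y = E x /\ forall z, C z = 0 -> inner y z = 0.
  have [_ [y _ <-] [n nW Bx]] : sum_set (range A) (orthoW W (range A)) (B x).
    by apply: rc; exists x.
  exists (y - P' y); split; last by move=> z Cz; rewrite innerBl iP' // subrr.
  rewrite (opB lC) (VP' y) subr0 /E /= -Bx (opD lW) (opD lA').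
  have -> : adjoint_op A (W n) = 0; last by rewrite addr0.
  apply: rdot_inj => z; rewrite rdot0l /rdot hA' nW //; by exists z.
have CX x : C (X x) = E x by case: (hX x).
have Xk x z : C z = 0 -> inner (X x) z = 0 by case: (hX x) => _; apply.
have lX : linear X.
  move=> a x y; pose d := X (a *: x + y) - (a *: X x + X y).
  have Cd : C d = 0.
    by rewrite /d (opB lC) (opD lC) (opZ lC) !CX (opD lE) (opZ lE) subrr.
  have : inner d d = 0.
    by rewrite {1}/d innerBl innerDl innerZl !Xk // mulr0 addr0 subrr.
  by move/inner_rdot0 => [/rdot_eq0/eqP + _]; rewrite subr_eq0 => /eqP.
have bX : bounded_op X by exact: (solution_bounded pC bE lX CX Xk).
exists X => // x; rewrite -[RHS]rnormN -(projection_error X); congr rnorm.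
apply/esym; apply: (ortho_projection_fix _ oP) => [|y].
  by apply: bop_lin; exact: bop_comp.
rewrite -[weighted_error X x]/(Q (A (X x) - B x)) /= -inner_sqrtW -hA'.
rewrite (opB lW) (opB lA').
by rewrite -[_ - _]/(C (X x) - E x) CX subrr; exact: linear0l.
Qed.

(** [|P Q B x|^2 = <Q P Q B x, B x>] since [P] is a projection. *)
Lemma shorted_error_norm x :
  rnorm ((sqrt_op (shorted W (range A)) \o B) x) = rnorm (optimal_error x).
Proof.
have pP := ortho_projection_positive oP; have [pQ QQ] := sqrt_opP pW.
have eS := shortedE pW bA oP.
have pS : positive_op (shorted W (range A)).
  have bP := positive_bop pP; have bQ := positive_bop pQ.
  rewrite eS; apply: positiveI => [|y z|y] /=.
  - by apply: bop_comp => //; exact: bop_comp.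
  - by rewrite positive_sa // positive_sa // positive_sa.
  - by rewrite positive_sa // positive_ge0.
have [pr sq] := sqrt_opP pS.
apply/eqP; rewrite -(@eqrXn2 _ 2) ?rnorm_ge0 // -[X in X ^+ 2 == _]/(rnorm (sqrt_op _ (B x))).
rewrite -rdot_norm -positive_sa //.
rewrite -[sqrt_op _ (sqrt_op _ _)]/((sqrt_op (shorted W (range A)) \o
   sqrt_op (shorted W (range A))) (B x)) sq eS /=.
by rewrite positive_sa // (ortho_projection_rdot _ oP).
Qed.

Lemma shorted_error_bop : bounded_op (sqrt_op (shorted W (range A)) \o B).
Proof.
have pP := ortho_projection_positive oP; have [pQ QQ] := sqrt_opP pW.
have bP := positive_bop pP; have bQ := positive_bop pQ.
have pS : positive_op (shorted W (range A)).
  rewrite (shortedE pW bA oP); apply: positiveI => [|y z|y] /=.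
  - by apply: bop_comp => //; exact: bop_comp.
  - by rewrite positive_sa // positive_sa // positive_sa.
  - by rewrite positive_sa // positive_ge0.
by have [/positive_bop bS _] := sqrt_opP pS; exact: bop_comp.
Qed.

End Approximation.

(** * Minimizing the Schatten norm *)

Section SchattenNorm.
Context {R : realType} {H : hilbertType R}.
Implicit Types (S T : H -> H) (p : R).

Lemma schatten_norm_le p S T : 0 < p ->
  (schatten_sum p S <= schatten_sum p T)%E -> (schatten_norm p S <= schatten_norm p T)%E.
Proof.
move=> p0 h; apply: gt0_ler_poweR => //; first by rewrite invr_ge0 ltW.
  by rewrite in_itv /= leey andbT; exact: eigensum_ge0.
by rewrite in_itv /= leey andbT; exact: eigensum_ge0.
Qed.

Lemma schatten_norm_inj p S T : 0 < p ->
  schatten_norm p S = schatten_norm p T -> schatten_sum p S = schatten_sum p T.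
Proof.
move=> p0 h; have := congr1 (fun x => x `^ p)%E h; rewrite /schatten_norm -!poweRrM.
by rewrite mulVf ?gt_eqF // !poweRe1 //; exact: eigensum_ge0.
Qed.

End SchattenNorm.

Theorem theorem4p5 (R : realType) (H : hilbertType R)
    (sepH : separable_space H) (A B W : H -> H) (p : R)
    (bA : bounded_op A) (clA : closed (range A)) (bB : bounded_op B)
    (posW : positive_op W) (p1 : 1 <= p)
    (WSp : schatten_class p (sqrt_op W)) :
  let range_cond :=
    range B `<=` sum_set (range A) (orthoW W (range A)) in
  let values :=
    [set schatten_normW p W ((A \o X) \- B) | X in bounded_op] in
  let v := schatten_norm p (sqrt_op (shorted W (range A)) \o B) in
  [/\ (exists m, is_minimum values m) <-> range_cond,
      range_cond -> is_minimum values v &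
      range_cond -> forall X0, bounded_op X0 ->
        (schatten_normW p W ((A \o X0) \- B) = v <-> W_inverse W A B X0)].
Proof.
move=> range_cond values v.
have [pQ QQ] := sqrt_opP posW; have bQ := positive_bop pQ.
have [cQ fQ] := WSp; have p0 : 0 < p by apply: lt_le_trans p1.
have lQA : linear (sqrt_op W \o A) by apply: bop_lin; exact: bop_comp.
have [P oP] := ortho_projection_exists lQA.
have bP := positive_bop (ortho_projection_positive oP).
pose err := weighted_error A B W; pose opt := optimal_error B W P.
have berr X : bounded_op X -> bounded_op (err X) by exact: weighted_error_bop.
have bopt : bounded_op opt by apply: optimal_error_bop oP.
have bdiff X : bounded_op X -> bounded_op ((A \o X) \- B).
  by move=> bX; apply: bop_sub => //; exact: bop_comp.
have cerr X : bounded_op X -> modulus_clustering (err X).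
  by move=> bX; apply: (modulus_clustering_comp cQ (@bop_id _ _) (bdiff X bX)).
have copt : modulus_clustering opt by exact: (modulus_clustering_comp cQ bP bB).
have ferr X : bounded_op X -> (schatten_sum p (err X) < +oo)%E.
  by move=> bX; apply: (schatten_sum_comp_fin p1 pQ cQ (bdiff X bX) fQ).
have ev : v = schatten_norm p opt.
  rewrite /v /schatten_norm /schatten_sum (abs_op_norm_eq _ bopt) //.
    exact: shorted_error_bop oP.
  exact: shorted_error_norm oP.
have vle X : bounded_op X -> (v <= schatten_norm p (err X))%E.
  move=> bX; rewrite ev; apply: schatten_norm_le => //.
  apply: schatten_sum_mono; [exact: p1|exact: bopt|exact: berr|exact: cerr|].
  move=> x. exact: (optimal_error_le B posW oP X x).
have vmin : range_cond -> is_minimum values v.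
  move=> rc; have [X bX hX] := optimal_error_attained bA bB posW oP rc.
  split; last by move=> _ [Y bY <-]; apply: (vle Y).
  exists X => //; rewrite ev /schatten_normW /schatten_norm /schatten_sum.
  by rewrite (abs_op_norm_eq (berr X bX) bopt).
split; [split; last by move=> rc; exists v; apply: vmin|by []|].
  move=> [m [[X0 bX0 <-] lb]]; apply: (range_condition_of posW (X0 := X0)) => x0 y0.
  apply/eqP; apply: contraT => /(error_descent bA bB posW bX0)[X [bX le_err lt_err]].
  have le_sum : (schatten_sum p (err X) <= schatten_sum p (err X0))%E.
    by apply: schatten_sum_mono le_err => //; [exact: berr|exact: berr|exact: cerr].
  have eq_norm : schatten_norm p (err X) = schatten_norm p (err X0).
    apply/eqP; rewrite eq_le schatten_norm_le //=.
    by apply: lb; exists X.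
  have eq_sum := schatten_norm_inj p0 eq_norm.
  have := schatten_sum_strict p1 (berr X bX) (berr X0 bX0) (cerr X bX) (cerr X0 bX0)
    le_err (ferr X0 bX0) eq_sum x0.
  by move=> eq_err; rewrite eq_err ltxx in lt_err.
move=> rc X0 bX0; rewrite ev; split=> [eq_norm|[_ opt_X0]].
  split=> // x z; rewrite !seminormWE // lecR.
  have eq_sum := schatten_norm_inj p0 eq_norm.
  have := schatten_sum_strict p1 bopt (berr X0 bX0) copt (cerr X0 bX0)
    (optimal_error_le B posW oP X0) (ferr X0 bX0) (esym eq_sum) x.
  rewrite -[sqrt_op W _]/(err X0 x) => <-.
  exact: (optimal_error_le B posW oP (fun=> z) x).
have [X bX hX] := optimal_error_attained bA bB posW oP rc.
rewrite /schatten_normW /schatten_norm /schatten_sum; congr (esum _ _ `^ _)%E.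
apply/funext => l; congr (subspace_dim (eigenspace_op _ _) * _)%E.
apply: abs_op_norm_eq => // [|x]; first exact: berr.
apply/eqP; rewrite eq_le; apply/andP; split; last exact: (optimal_error_le B posW oP X0).
have := opt_X0 x (X x); rewrite !seminormWE // lecR => /le_trans; apply.
by rewrite -[sqrt_op W _]/(err X x) hX.
Qed.
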